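(* Let $(D,I)$ be a nondegenerate real analytic CR-structure on a $3$-manifold $M$. Then for every point $p\in M$ there exist a neighbourhood $U_p\subset M$ of $p$ and a real analytic embedding $\varphi:U_p\to\mathbb{C}^2$ such that $(D,I)$ is, on $U_p$, the CR-structure induced by the embedding $\varphi$.
   Context: A CR-structure on a $3$-manifold $M$ consists of a rank $2$ subbundle $D\subset TM$ and a vector bundle endomorphism $I:D\to D$ satisfying $I^2=-\mathrm{Id}_D$. It is nondegenerate if $D$ is nowhere integrable, i.e. a contact plane field. It is real analytic if $M$, $D$ and $I$ are real analytic. Let $J$ denote the standard complex structure on $\mathbb{C}^2$. A hypersurface $N\subset\mathbb{C}^2$ carries the CR-structure whose plane field at $q\in N$ is the largest $J_q$-invariant subspace of $T_qN$ and whose endomorphism at $q$ is the restriction of $J_q$ to that subspace. The CR-structure on $U$ induced by an embedding $\varphi:U\to\mathbb{C}^2$ of a $3$-manifold $U$ is the one corresponding, under the differential of $\varphi$, to this CR-structure on the hypersurface $\varphi(U)$. *)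

(* Defs.v *)
From HB Require Import structures.
From mathcomp Require Import all_boot all_order all_algebra finmap.
From mathcomp Require Import all_classical all_reals all_analysis.
From mathcomp Require Import summability.
From mathcomp Require Import complex.

Set Implicit Arguments.
Unset Strict Implicit.
Unset Printing Implicit Defensive.

Import Order.TTheory GRing.Theory Num.Theory.
Import numFieldNormedType.Exports.

Local Open Scope classical_set_scope.
Local Open Scope ring_scope.

(* Near a, f is the sum of a power series in n variables, indexed by the
   multi-indices m; the sum is taken along the filter of finite sets of
   multi-indices, i.e. the series converges unconditionally (equivalently,
   absolutely). *)
Definition analytic_fun_at (R : realType) (n : nat)
    (f : 'rV[R]_n -> R) (a : 'rV[R]_n) : Prop :=
  exists (c : {ffun 'I_n -> nat} -> R) (r : R), 0 < r /\
    forall x : 'rV[R]_n, `|x - a| < r ->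
      partial_sum (fun m : {ffun 'I_n -> nat} =>
        c m * \prod_(i < n) (x 0 i - a 0 i) ^+ m i) @ totally --> f x.

Definition analytic_at (R : realType) (n m : nat)
    (f : 'rV[R]_n -> 'rV[R]_m) (a : 'rV[R]_n) : Prop :=
  forall j : 'I_m, analytic_fun_at (fun x => f x 0 j) a.

(* C^oo on the open set V: every iterated partial derivative (s lists the
   directions) is differentiable at every point of V. *)
Definition smooth_on (R : realType) (n m : nat)
    (V : set 'rV[R]_n) (f : 'rV[R]_n -> 'rV[R]_m) : Prop :=
  forall (s : seq 'I_n) (x : 'rV[R]_n), V x ->
    differentiable (foldr (fun i g => 'D_(delta_mx 0 i : 'rV[R]_n) g) f s) x.

(* The values of chart_map outside chart_dom, and of chart_inv outside the
   image of chart_dom, are irrelevant. *)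
Record chart (R : realType) (n : nat) (M : topologicalType) : Type := Chart {
  chart_dom : set M;
  chart_map : M -> 'rV[R]_n;
  chart_inv : 'rV[R]_n -> M;
  chart_dom_open : open chart_dom;
  chart_img_open : open (chart_map @` chart_dom);
  chart_mapK : forall p, chart_dom p -> chart_inv (chart_map p) = p;
  chart_map_continuous :
    forall p, chart_dom p -> {for p, continuous chart_map};
  chart_inv_continuous :
    forall p, chart_dom p -> {for chart_map p, continuous chart_inv} }.

(* Real analytic n-manifolds (without boundary). Besides the atlas there is a
   preferred chart chart_at p around each point p; its only purpose is to
   identify the tangent space T_p M with 'rV[R]_n. *)
Record analytic_manifold (R : realType) (n : nat) : Type := AnalyticManifold {
  carrier :> topologicalType;
  carrier_hausdorff : hausdorff_space carrier;
  carrier_second_countable : @second_countable carrier;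
  atlas : set (chart R n carrier);
  atlas_analytic : forall c c', atlas c -> atlas c' ->
    forall p, chart_dom c p -> chart_dom c' p ->
      analytic_at (chart_map c' \o chart_inv c) (chart_map c p);
  chart_at : carrier -> chart R n carrier;
  chart_at_atlas : forall p, atlas (chart_at p);
  chart_at_dom : forall p, chart_dom (chart_at p) p }.

Section Manifold.
Variables (R : realType) (n : nat) (M : analytic_manifold R n).

Definition chart_around (p : M) (c : chart R n M) : Prop :=
  atlas c /\ chart_dom c p.

Definition analytic_map_on (m : nat) (U : set M) (f : M -> 'rV[R]_m) : Prop :=
  forall p, U p -> forall c, chart_around p c ->
    analytic_at (f \o chart_inv c) (chart_map c p).

(* The differential T_p M -> R^m of f at p. In particular, for a chart c around
   p, mdiff (chart_map c) p v is the coordinate vector of v : T_p M in c. *)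
Definition mdiff (m : nat) (f : M -> 'rV[R]_m) (p : M) :
    'Hom('rV[R]_n, 'rV[R]_m) :=
  linfun ('d (f \o chart_inv (chart_at p)) (chart_map (chart_at p) p)).

(* Vector fields are functions X with X p in T_p M = 'rV[R]_n. *)
Definition analytic_field_on (U : set M) (X : M -> 'rV[R]_n) : Prop :=
  forall p, U p -> forall c, chart_around p c ->
    analytic_at
      (fun y => mdiff (chart_map c) (chart_inv c y) (X (chart_inv c y)))
      (chart_map c p).

(* f restricted to the open set U is an analytic injective immersion which is a
   homeomorphism onto its image (continuity follows from analyticity). *)
Definition analytic_embedding (m : nat) (U : set M) (f : M -> 'rV[R]_m) :
    Prop :=
  [/\ analytic_map_on U f,
      forall p, U p -> injective (mdiff f p),
      forall p q, U p -> U q -> f p = f q -> p = q &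
      forall W : set M, open W -> W `<=` U ->
        exists2 V : set 'rV[R]_m, open V & f @` W = V `&` f @` U].

End Manifold.

Section CR.
Variables (R : realType) (M : analytic_manifold R 3).

Definition analytic_plane_field (D : M -> {vspace 'rV[R]_3}) : Prop :=
  (forall p, \dim (D p) = 2) /\
  forall p, exists (U : set M) (X Y : M -> 'rV[R]_3),
    [/\ open U, U p, analytic_field_on U X, analytic_field_on U Y &
        forall q, U q -> D q = <<[:: X q; Y q]>>%VS].

(* An endomorphism of D p is represented by any endomorphism of T_p M extending
   it; the values of I p outside D p are irrelevant. *)
Definition analytic_CR_structure
    (D : M -> {vspace 'rV[R]_3}) (I : M -> 'End('rV[R]_3)) : Prop :=
  [/\ analytic_plane_field D,
      forall p v, v \in D p -> I p v \in D p,
      forall p v, v \in D p -> I p (I p v) = - v &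
      forall (U : set M) (X : M -> 'rV[R]_3), open U ->
        analytic_field_on U X -> (forall q, U q -> X q \in D q) ->
        analytic_field_on U (fun q => I q (X q))].

(* 1-forms on open subsets of R^3, given by their three components *)
Definition covec_app (a v : 'rV[R]_3) : R := \sum_(i < 3) a 0 i * v 0 i.

Definition ext_deriv (alpha : 'rV[R]_3 -> 'rV[R]_3) (y u v : 'rV[R]_3) : R :=
  covec_app ('d alpha y u) v - covec_app ('d alpha y v) u.

(* alpha /\ d alpha *)
Definition wedge_ext_deriv (alpha : 'rV[R]_3 -> 'rV[R]_3)
    (y u v w : 'rV[R]_3) : R :=
  covec_app (alpha y) u * ext_deriv alpha y v w
  + covec_app (alpha y) v * ext_deriv alpha y w u
  + covec_app (alpha y) w * ext_deriv alpha y u v.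

(* Nondegeneracy: D is locally (in a chart c) the kernel of a smooth 1-form alpha such that
   alpha /\ d alpha vanishes nowhere. *)
Definition contact_plane_field (D : M -> {vspace 'rV[R]_3}) : Prop :=
  forall p, exists (c : chart R 3 M) (V : set 'rV[R]_3)
      (alpha : 'rV[R]_3 -> 'rV[R]_3),
    [/\ chart_around p c,
        [/\ open V, V (chart_map c p) & V `<=` chart_map c @` chart_dom c],
        smooth_on V alpha,
        forall q, chart_dom c q -> V (chart_map c q) -> forall v,
          (v \in D q) <->
          covec_app (alpha (chart_map c q)) (mdiff (chart_map c) q v) = 0 &
        forall y, V y -> exists u v w, wedge_ext_deriv alpha y u v w != 0].

(* Real coordinates (Re z_1, Re z_2, Im z_1, Im z_2) on C^2; they define its
   topology and its real analytic structure, and identify its tangent spaces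
   with 'rV[R]_(2 + 2). *)
Definition real_coord (z : 'rV[R[i]]_2) : 'rV[R]_(2 + 2) :=
  row_mx (map_mx (@complex.Re R) z) (map_mx (@complex.Im R) z).

Definition Jstd (w : 'rV[R]_(2 + 2)) : 'rV[R]_(2 + 2) :=
  row_mx (- rsubmx w) (lsubmx w).

Lemma real_coord_mulI (z : 'rV[R[i]]_2) :
  real_coord ('i%C *: z) = Jstd (real_coord z).
Proof.
rewrite /Jstd /real_coord row_mxKl row_mxKr; congr row_mx;
  by apply/rowP => k; rewrite !mxE; case: (z 0 k) => a b /=;
     rewrite !(mul0r, mul1r, sub0r, add0r, addr0).
Qed.

Definition largest_J_invariant (T H : {vspace 'rV[R]_(2 + 2)}) : Prop :=
  let J_invariant (K : {vspace 'rV[R]_(2 + 2)}) :=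
    forall w, w \in K -> Jstd w \in K in
  [/\ (H <= T)%VS, J_invariant H &
      forall K, (K <= T)%VS -> J_invariant K -> (K <= H)%VS].

(* (D, I) is, on U, the CR-structure induced by the embedding phi of U: the
   tangent space of the hypersurface phi(U) at phi(q) is the image of dphi_q,
   and dphi_q carries (D q, I q) to the largest J-invariant subspace of it with
   the restriction of J. *)
Definition CR_induced_by (D : M -> {vspace 'rV[R]_3})
    (I : M -> 'End('rV[R]_3)) (U : set M) (phi : M -> 'rV[R[i]]_2) : Prop :=
  forall q, U q ->
    let dphi := mdiff (real_coord \o phi) q in
    largest_J_invariant (limg dphi) (dphi @: D q)%VS /\
    (forall v, v \in D q -> dphi (I q v) = Jstd (dphi v)).

End CR.

(* Main.v *)
(* In a chart, let xi and eta be the coordinate expressions of an analytic section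
   X of D without zeros and of I X. A complex function f is CR when
   df(eta) = i df(xi), i.e. zeta f = 0 for zeta = eta - i xi. Some component zeta_t
   is nonzero at the base point, so this is a linear equation
   f_t = - \sum_(j <> t) (zeta_j / zeta_t) f_j with analytic coefficients, and the
   Cauchy-Kovalevskaya theorem gives solutions f_1, f_2 restricting to the two
   coordinates x_j (j <> t) on x_t = 0. The map (f_1, f_2) is an immersion because
   xi and eta are linearly independent, hence an embedding near the base point, and
   the image of D is the only possible maximal J-invariant subspace since the
   tangent space of the image has odd dimension.

   For the linear Cauchy-Kovalevskaya theorem one solves for g = d_t U, which
   satisfies g = B + \sum A_j (d_j \int dx_t) g. In the l^1 norm on coefficients
   with weight rho^|m| lam^(m_t) / binomial(|m|, m_t), multiplication is
   continuous and d_j \int dx_t has norm at most lam, so a Neumann series converges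
   for small lam. *)
Require Import Defs.
From mathcomp Require Import all_boot all_order all_algebra finmap.
From mathcomp Require Import all_classical all_reals all_analysis.
From mathcomp Require Import summability complex.
From mathcomp Require Import ring lra.

Set Implicit Arguments.
Unset Strict Implicit.
Unset Printing Implicit Defensive.

Import Order.TTheory GRing.Theory Num.Theory.
Import numFieldNormedType.Exports.

Local Open Scope classical_set_scope.
Local Open Scope ring_scope.

#[local] Existing Instance totally_filter.

(** * Unconditional summation *)

Section Sums.
Variable R : realType.

(** The difficulty in the Cauchy-Kovalevskaya step is that d_j \int dx_t multiplies coefficients by
    quotients of exponents m_j / m_t, which no weight depending on |m| alone, nor a mere factor
    lam^(m_t), can absorb. The anisotropic weight is used only for the iteration: it is squeezed
    between two isotropic weights, so data come in from a polydisc and the solution goes back to a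
    smaller one. No inverse function theorem is invoked. The derivative always comes with a
    quadratic Taylor remainder whose constant does not depend on the base point. For an immersion
    this yields |x - y| <= k |F x - F y| on a whole ball, and from this single inequality follow
    injectivity, injectivity of the differential at every nearby point, and openness of the map onto
    its image. The CR equation is solved for one nonvanishing section X of D only. Since X and I X
    span D, compatibility with J at X extends to all of D by linearity. *)

Lemma big_fset_sub (I : choiceType) (F : I -> R) (A B : {fset I}) :
  (A `<=` B)%fset ->
  \sum_(i <- B) F i = \sum_(i <- A) F i + \sum_(i <- (B `\` A)%fset) F i.
Proof.
move=> sAB; rewrite (big_fsetID _ (mem A)) /=; congr (_ + _); apply: eq_fbig => // i.
  rewrite !inE; apply/idP/idP => [/andP[]//|iA].
  by rewrite iA (fsubsetP sAB).
by rewrite !inE andbC.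
Qed.

Lemma big_fset_disjU (I : choiceType) (F : I -> R) (A B : {fset I}) :
  [disjoint A & B]%fset ->
  \sum_(i <- (A `|` B)%fset) F i = \sum_(i <- A) F i + \sum_(i <- B) F i.
Proof.
move=> dAB; rewrite (big_fset_sub _ (fsubsetUl A B)); congr (_ + _).
apply: eq_fbig => // i; rewrite !inE; case: (boolP (i \in A)) => //= iA.
by apply/esym/negbTE; exact: (fdisjointP dAB).
Qed.

(** Absolute summability with an explicit bound. The total of the absolute values is never named: a
    bound on all finite subsums gives convergence and norm estimates, and it survives comparison
    without any limit argument. *)
Definition bsum (I : choiceType) (c : I -> R) (N : R) : Prop :=
  forall J : {fset I}, \sum_(i <- J) `|c i| <= N.

Definition has_sum (I : choiceType) (c : I -> R) (l : R) : Prop :=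
  partial_sum c @ totally --> l.

Lemma partial_sumE (I : choiceType) (c : I -> R) (J : {fset I}) :
  partial_sum c J = \sum_(i <- J) c i.
Proof. by rewrite /partial_sum big_seq_fsetE. Qed.

Lemma has_sumP (I : choiceType) (c : I -> R) (l : R) :
  has_sum c l <-> forall e : R, 0 < e -> exists J0 : {fset I},
    forall J : {fset I}, (J0 `<=` J)%fset -> `|\sum_(i <- J) c i - l| <= e.
Proof.
split=> [h e e0|h].
  move/cvgrPdist_le: h => /(_ _ e0)[J0 _ hJ].
  exists J0 => J sJ; rewrite distrC -partial_sumE; exact: hJ.
apply/cvgrPdist_le => e e0; have [J0 hJ] := h e e0.
exists J0 => //= J sJ; rewrite distrC partial_sumE; exact: hJ.
Qed.

Lemma has_sum_unique (I : choiceType) (c : I -> R) (l l' : R) :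
  has_sum c l -> has_sum c l' -> l = l'.
Proof. by move=> h h'; apply: (cvg_unique _ h h'); exact: norm_hausdorff. Qed.

Lemma eq_has_sum (I : choiceType) (c d : I -> R) (l : R) :
  c =1 d -> has_sum c l -> has_sum d l.
Proof. by move=> /funext ->. Qed.

Lemma has_sumD (I : choiceType) (c d : I -> R) (l k : R) :
  has_sum c l -> has_sum d k -> has_sum (fun i => c i + d i) (l + k).
Proof.
move=> h h'; rewrite /has_sum.
have -> : partial_sum (fun i => c i + d i) =
          (fun J => partial_sum c J + partial_sum d J).
  by apply/funext => J; rewrite !partial_sumE big_split.
exact: cvgD.
Qed.

Lemma has_sumZ (I : choiceType) (c : I -> R) (l a : R) :
  has_sum c l -> has_sum (fun i => a * c i) (a * l).
Proof.
move=> h; rewrite /has_sum.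
have -> : partial_sum (fun i => a * c i) = (fun J => a * partial_sum c J).
  by apply/funext => J; rewrite !partial_sumE mulr_sumr.
exact: cvgMl_tmp.
Qed.

Arguments has_sumZ [I c l] a _.

Lemma has_sumN (I : choiceType) (c : I -> R) (l : R) :
  has_sum c l -> has_sum (fun i => - c i) (- l).
Proof.
move=> /(has_sumZ (-1)); rewrite mulN1r; apply: eq_has_sum => i.
by rewrite mulN1r.
Qed.

Lemma has_sumB (I : choiceType) (c d : I -> R) (l k : R) :
  has_sum c l -> has_sum d k -> has_sum (fun i => c i - d i) (l - k).
Proof. by move=> h /has_sumN h'; exact: has_sumD. Qed.

Lemma has_sum0 (I : choiceType) : has_sum (fun _ : I => 0) 0.
Proof.
by apply/has_sumP => e e0; exists fset0 => J _; rewrite big1// subrr normr0 ltW.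
Qed.

Lemma has_sum_sum (I : choiceType) (K : Type) (r : seq K) (P : pred K)
    (c : K -> I -> R) (l : K -> R) :
  (forall k, P k -> has_sum (c k) (l k)) ->
  has_sum (fun i => \sum_(k <- r | P k) c k i) (\sum_(k <- r | P k) l k).
Proof.
move=> h; elim: r => [|k r IH].
  by rewrite big_nil; apply: (eq_has_sum _ (has_sum0 I)) => i; rewrite big_nil.
rewrite big_cons; case: ifP => Pk.
  apply: (eq_has_sum _ (has_sumD (h _ Pk) IH)) => i.
  by rewrite big_cons Pk.
by apply: (eq_has_sum _ IH) => i; rewrite big_cons Pk.
Qed.

Lemma has_sum1 (I : choiceType) (c : I -> R) (i0 : I) :
  (forall i, i != i0 -> c i = 0) -> has_sum c (c i0).
Proof.
move=> h; apply/has_sumP => e e0; exists [fset i0]%fset => J.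
rewrite fsub1set => iJ.
by rewrite (big_fsetD1 i0)//= big_seq big1 ?addr0 ?subrr ?normr0 ?ltW// => i;
  rewrite !inE => /andP[/h].
Qed.

Lemma bsum_ge0 (I : choiceType) (c : I -> R) (N : R) : bsum c N -> 0 <= N.
Proof. by move=> /(_ fset0); rewrite big_nil. Qed.

Lemma bsum_le (I : choiceType) (c d : I -> R) (N M : R) :
  (forall i, `|d i| <= `|c i|) -> N <= M -> bsum c N -> bsum d M.
Proof.
move=> h NM b J; apply: (le_trans _ NM); apply: (le_trans _ (b J)).
by apply: ler_sum => i _.
Qed.

Lemma eq_bsum (I : choiceType) (c d : I -> R) (N : R) :
  c =1 d -> bsum c N -> bsum d N.
Proof. by move=> /funext ->. Qed.

Lemma bsumZ (I : choiceType) (c : I -> R) (N a : R) :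
  bsum c N -> bsum (fun i => a * c i) (`|a| * N).
Proof.
move=> b J; under eq_bigr do rewrite normrM.
by rewrite -mulr_sumr ler_wpM2l.
Qed.

Lemma bsumD (I : choiceType) (c d : I -> R) (N M : R) :
  bsum c N -> bsum d M -> bsum (fun i => c i + d i) (N + M).
Proof.
move=> b b' J; apply: (le_trans _ (lerD (b J) (b' J))).
by rewrite -big_split; apply: ler_sum => i _; exact: ler_normD.
Qed.

(** The supremum of the finite sums is attained up to [e] on some [J0]; a set disjoint from [J0]
    cannot add more than [e]. *)
Lemma bsum_tail (I : choiceType) (c : I -> R) (N e : R) :
  bsum c N -> 0 < e -> exists J0 : {fset I}, forall J : {fset I},
    [disjoint J0 & J]%fset -> \sum_(i <- J) `|c i| <= e.
Proof.
move=> b e0; pose E := [set \sum_(i <- J) `|c i| | J in [set: {fset I}]].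
have sE : has_sup E.
  split; first by exists (\sum_(i <- fset0) `|c i|), fset0.
  by exists N => _ [J _ <-]; exact: b.
have [_ [J0 _ <-] hJ0] := sup_adherent e0 sE.
exists J0 => J dJ.
have : \sum_(i <- (J0 `|` J)%fset) `|c i| <= sup E.
  by apply: ub_le_sup => //; [exact: sE.2|exists (J0 `|` J)%fset].
rewrite big_fset_disjU //=.
by move=> h; lra.
Qed.

Lemma bsum_cauchy (I : choiceType) (c : I -> R) (N e : R) :
  bsum c N -> 0 < e -> exists J0 : {fset I}, forall J J' : {fset I},
    (J0 `<=` J)%fset -> (J `<=` J')%fset ->
    `|\sum_(i <- J') c i - \sum_(i <- J) c i| <= e.
Proof.
move=> b e0; have [J0 hJ0] := bsum_tail b e0; exists J0 => J J' s s'.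
rewrite (big_fset_sub _ s') addrC addKr.
apply: (le_trans (ler_norm_sum _ _ _)); apply: hJ0.
apply/fdisjointP => i iJ0; rewrite inE negb_and negbK.
by rewrite (fsubsetP s _ iJ0).
Qed.

Lemma bsum_has_sum (I : choiceType) (c : I -> R) (N : R) :
  bsum c N -> exists l, has_sum c l.
Proof.
move=> b; exists (lim (partial_sum c @ totally)); rewrite /has_sum.
apply/cauchy_cvgP/cauchy_exP => e e0.
have e20 : 0 < e / 2 by lra.
have [J0 hJ0] := bsum_cauchy b e20.
exists (partial_sum c J0); exists J0 => //= J sJ.
rewrite /ball /= !partial_sumE distrC (le_lt_trans (hJ0 _ _ _ sJ)) //; lra.
Qed.

Lemma has_sum_norm_le (I : choiceType) (c : I -> R) (N l : R) :
  bsum c N -> has_sum c l -> `|l| <= N.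
Proof.
move=> b /has_sumP h; apply/ler_addgt0Pr => e e0.
have [J hJ] := h _ e0; have := hJ J (fsubset_refl _) => h1.
have h2 := b J.
have h3 : `|\sum_(i <- J) c i| <= N := le_trans (ler_norm_sum _ _ _) h2.
have -> : l = \sum_(i <- J) c i - (\sum_(i <- J) c i - l) by ring.
by rewrite (le_trans (ler_normB _ _))// lerD.
Qed.

(** Unconditional convergence of real families is absolute. By the Cauchy property every finite sum
    avoiding [J0] is at most 2 in absolute value; applied separately to the nonnegative and the
    negative terms, this bounds the absolute sum outside [J0] by 4. *)
Lemma has_sum_bounded (I : choiceType) (c : I -> R) (l : R) :
  has_sum c l -> exists N, bsum c N.
Proof.
move=> /has_sumP /(_ 1 ltr01) [J0 hJ0].
have small (H : {fset I}) : [disjoint J0 & H]%fset ->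
    `|\sum_(i <- H) c i| <= 2.
  move=> dH.
  have := hJ0 (J0 `|` H)%fset (fsubsetUl _ _); have := hJ0 _ (fsubset_refl J0).
  rewrite big_fset_disjU //= => h1 h2.
  set a := \sum_(i <- J0) _ in h1 h2; set s := \sum_(i <- H) _ in h2 *.
  have -> : s = (a + s - l) - (a - l) by ring.
  by rewrite (le_trans (ler_normB _ _))//; lra.
exists (\sum_(i <- J0) `|c i| + 4) => J.
have half (P : pred I) : `|\sum_(i <- J | (i \notin J0) && P i) c i| <= 2.
  have := small [fset i in J | (i \notin J0) && P i]%fset.
  rewrite big_fset /=; apply.
  by apply/fdisjointP => i iJ0; rewrite !inE iJ0 andbF.
have e1 : \sum_(i <- J | i \notin J0) `|c i| <= 4.
  rewrite (bigID (fun i => 0 <= c i)) /=.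
  have -> : \sum_(i <- J | (i \notin J0) && (0 <= c i)) `|c i| =
            \sum_(i <- J | (i \notin J0) && (0 <= c i)) c i.
    by apply: eq_bigr => i /andP[_ /ger0_norm].
  have -> : \sum_(i <- J | (i \notin J0) && ~~ (0 <= c i)) `|c i| =
            - \sum_(i <- J | (i \notin J0) && ~~ (0 <= c i)) c i.
    rewrite -sumrN; apply: eq_bigr => i /andP[_].
    by rewrite -ltNge => /ltr0_norm.
  have := half (fun i => 0 <= c i); have := half (fun i => ~~ (0 <= c i)).
  by rewrite !ler_norml => /andP[? ?] /andP[? ?]; lra.
rewrite (bigID (mem J0)) /= lerD //.
have -> : \sum_(i <- J | i \in J0) `|c i| =
          \sum_(i <- [fset i in J | i \in J0]%fset) `|c i|.
  by rewrite big_fset.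
have -> : [fset i in J | i \in J0]%fset = (J0 `&` J)%fset.
  by apply/fsetP => i; rewrite !inE andbC.
rewrite [leRHS](big_fsetID _ (mem J)) /=.
have -> : [fset x | x in J0 & mem J x]%fset = (J0 `&` J)%fset.
  by apply/fsetP => i; rewrite !inE.
by rewrite lerDl sumr_ge0.
Qed.

(** Regrouping along the fibres of [p]. A fibre sum is written as a sum over all of [T] of the terms
    cut off outside the fibre, so that finitely many fibre sums can be added as families over the
    same index type. *)
Lemma has_sum_fibre (T I : choiceType) (p : T -> I) (c : T -> R) (r : I -> R)
    (N : R) :
  bsum c N -> (forall i, has_sum (fun t => c t *+ (p t == i)) (r i)) ->
  bsum r N /\ forall S, has_sum c S -> has_sum r S.
Proof.
move=> b h.
have part (J : {fset I}) (T0 : {fset T}) (d : T -> R) :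
    \sum_(i <- J) \sum_(t <- T0) d t *+ (p t == i) =
    \sum_(t <- [fset t in T0 | p t \in J]%fset) d t.
  rewrite exchange_big big_fset /= [RHS]big_mkcond /=; apply: eq_bigr => t _.
  case: ifPn => ptJ.
    rewrite (big_fsetD1 (p t))//= eqxx mulr1n big_seq big1 ?addr0// => i.
    by rewrite !inE eq_sym => /andP[/negbTE->].
  by rewrite big_seq big1// => i iJ; case: eqP => // e; rewrite e iJ in ptJ.
split=> [J|S hS].
  apply/ler_addgt0Pr => e e0.
  (* Multiplying by signs makes the sum of absolute values linear in the fibre sums, so a single
     finite subset of [T] approximates all of it. *)
  pose s := fun i => Num.sg (r i).
  have -> : \sum_(i <- J) `|r i| = \sum_(i <- J) s i * r i.
    by apply: eq_bigr => i _; rewrite normrEsg.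
  have := @has_sum_sum T I J xpredT (fun i t => s i * (c t *+ (p t == i)))
    (fun i => s i * r i) (fun i _ => has_sumZ (s i) (h i)).
  move=> /has_sumP /(_ _ e0)[T0 /(_ T0 (fsubset_refl _))].
  set a := (X in `|X - _|); set l := \sum_(i <- J) _ => ale.
  have aN : `|a| <= N.
    apply: (le_trans (ler_norm_sum _ _ _)).
    apply: (le_trans _ (b T0)).
    apply: ler_sum => t _.
    apply: (le_trans (ler_norm_sum _ _ _)).
    have [ptJ|ptJ] := boolP (p t \in J); last first.
      rewrite big_seq big1// => i iJ; case: eqP => [e1|]; last by rewrite mulr0 normr0.
      by rewrite e1 iJ in ptJ.
    rewrite (big_fsetD1 (p t))//= eqxx mulr1n big_seq big1 ?addr0.
      rewrite normrM normr_sg; case: (r (p t) != 0); rewrite ?mul1r ?mul0r //.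
    by move=> i; rewrite !inE eq_sym => /andP[/negbTE->]; rewrite mulr0 normr0.
  by move: aN ale; rewrite !ler_norml => /andP[_ ?] /andP[? _]; lra.
apply/has_sumP => e e0.
have e20 : 0 < e / 2 by lra.
move/has_sumP: hS => /(_ _ e20)[T0 hT0].
(* [T1] below may depend on [J]: since [J] contains the image of [T0], the part of [T0] and [T1]
   lying over [J] still contains [T0], so its sum is close to [S]. *)
exists [fset p t | t in T0]%fset => J sJ.
have := @has_sum_sum T I J xpredT (fun i t => (c t *+ (p t == i))) r
  (fun i _ => h i).
move=> /has_sumP /(_ _ e20)[T1 /(_ _ (fsubsetUr T0 T1))].
rewrite exchange_big part.
set a := \sum_(t <- _) _; set l := \sum_(i <- J) _ => al.
have : `|a - S| <= e / 2.
  apply: hT0; apply/fsubsetP => t tT0; rewrite !inE tT0 /=.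
  by apply: (fsubsetP sJ); apply/imfsetP; exists t.
by move: al; rewrite !ler_norml => /andP[? ?] /andP[? ?]; lra.
Qed.

Lemma has_sum_inj (I K : choiceType) (h : K -> I) (g : I -> K) (c : I -> R)
    (l : R) :
  cancel h g -> (forall i, c i != 0 -> h (g i) = i) ->
  has_sum c l -> has_sum (c \o h) l.
Proof.
move=> hg supp /has_sumP hc; apply/has_sumP => e e0.
have [T0 hT0] := hc e e0; exists [fset g t | t in T0]%fset => J sJ.
have -> : \sum_(i <- J) (c \o h) i =
          \sum_(i <- ([fset h k | k in J] `|` T0)%fset) c i.
  rewrite -(@big_fset_incl _ _ _ _ [fset h k | k in J]%fset) ?fsubsetUl //.
    by rewrite big_imfset //= => x y _ _ e1; rewrite -(hg x) e1 hg.
  move=> i; rewrite inE => /orP[->//|iT0 iJ].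
  apply/eqP; apply: contraNT iJ => ci.
  apply/imfsetP; exists (g i); last by rewrite supp.
  by apply: (fsubsetP sJ); apply/imfsetP; exists i.
by apply: hT0; exact: fsubsetUr.
Qed.

(** Injectivity of [h] is asked only on the support of [d], because lowering an exponent by
    truncated subtraction is injective only where that exponent is nonzero. *)
Lemma bsum_inj (I K : choiceType) (h : K -> I) (c : I -> R) (d : K -> R)
    (C N : R) :
  (forall k k', d k != 0 -> d k' != 0 -> h k = h k' -> k = k') ->
  (forall k, d k != 0 -> `|d k| <= C * `|c (h k)|) -> 0 <= C ->
  bsum c N -> bsum d (C * N).
Proof.
move=> hinj dc C0 b J.
rewrite (bigID (fun k => d k != 0)) /= [X in _ + X]big1 ?addr0; last first.
  by move=> k; rewrite negbK => /eqP->; rewrite normr0.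
rewrite big_fset_condE /=.
set A := [fset k in J | d k != 0]%fset.
have hA k : k \in A -> d k != 0 by rewrite !inE => /andP[].
have -> : \sum_(i <- A) `|d i| = \sum_(i <- A | d i != 0) `|d i|.
  by rewrite big_seq [RHS]big_seq_cond; apply: eq_bigl => k;
    case: (boolP (k \in A)) => //= /hA ->.
apply: (le_trans _ (ler_wpM2l C0 (b [fset h k | k in A]%fset))).
rewrite [X in _ <= _ * X]big_imfset /=; last first.
  by move=> x y /hA dx /hA dy; exact: hinj.
rewrite mulr_sumr big_seq_cond [leRHS]big_seq_cond big_mkcond [leRHS]big_mkcond.
apply: ler_sum => k _; rewrite andbT; case: (boolP (k \in A)) => //= kA.
by rewrite (hA k kA); apply/dc/hA.
Qed.

(** Fubini, as regrouping along the first projection; [bsum_swap] and [has_sum_swap] give the other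
    order. *)
Lemma has_sum_pair (I K : choiceType) (c : I * K -> R) (r : I -> R) (N S : R) :
  bsum c N -> has_sum c S -> (forall i, has_sum (fun k => c (i, k)) (r i)) ->
  bsum r N /\ has_sum r S.
Proof.
move=> b hS h.
have hf i : has_sum (fun t => c t *+ (t.1 == i)) (r i).
  have [l hl] : exists l, has_sum (fun t => c t *+ (t.1 == i)) l.
    apply: (@bsum_has_sum _ _ N); apply: (bsum_le _ (lexx N) b) => t.
    by case: (_ == _); rewrite ?mulr1n // mulr0n normr0.
  have := @has_sum_inj _ _ (fun k => (i, k)) snd _ _ _ _ hl.
  move=> /(_ (fun _ => erefl)) H.
  have /H : forall t : I * K, c t *+ (t.1 == i) != 0 -> (i, t.2) = t.
    by case=> i' k /=; have [->//|_] := eqVneq i' i; rewrite mulr0n eqxx.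
  rewrite /comp /= eqxx => hl'.
  by rewrite (has_sum_unique (h i) hl').
have [br hr] := has_sum_fibre b hf.
by split=> //; exact: hr.
Qed.

Lemma bsum_pair (I K : choiceType) (c : I * K -> R) (N_ : I -> R) (N : R) :
  (forall i, bsum (fun k => c (i, k)) (N_ i)) -> bsum N_ N -> bsum c N.
Proof.
move=> h b J.
pose A := [fset t.1 | t in J]%fset; pose B := [fset t.2 | t in J]%fset.
rewrite (partition_big_imfset _ fst) /=.
apply: (le_trans _ (b A)); apply: ler_sum => i _.
apply: (le_trans _ (ler_norm _)); apply: (le_trans _ (h i B)).
rewrite big_fset_condE /=.
set A' := [fset t in J | t.1 == i]%fset.
have hA t : t \in A' -> t.1 = i by rewrite !inE => /andP[_ /eqP].
have -> : \sum_(t <- A') `|c t| =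
          \sum_(k <- [fset t.2 | t in A']%fset) `|c (i, k)|.
  rewrite [RHS]big_imfset /=; last first.
    by move=> [x1 x2] [y1 y2] /hA /= -> /hA /= -> ->.
  by rewrite big_seq [RHS]big_seq; apply: eq_bigr => -[x1 x2] /hA /= ->.
have sB : ([fset t.2 | t in A'] `<=` B)%fset.
  apply/fsubsetP => k /imfsetP[t]; rewrite !inE => /andP[tJ _] ->.
  by apply/imfsetP; exists t.
by rewrite [leRHS](big_fset_sub _ sB) lerDl sumr_ge0.
Qed.

Lemma bsum_swap (I K : choiceType) (c : I * K -> R) (N : R) :
  bsum c N -> bsum (fun t : K * I => c (t.2, t.1)) N.
Proof.
move=> b; rewrite -[N]mul1r; apply: (bsum_inj (h := fun t => (t.2, t.1)) _ _ _ b).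
- by move=> [? ?] [? ?] _ _ /= [-> ->].
- by move=> k _; rewrite mul1r.
- exact: ler01.
Qed.

Lemma has_sum_swap (I K : choiceType) (c : I * K -> R) (S : R) :
  has_sum c S -> has_sum (fun t : K * I => c (t.2, t.1)) S.
Proof.
apply: (@has_sum_inj _ _ (fun t : K * I => (t.2, t.1)) (fun t => (t.2, t.1))).
- by case.
- by case.
Qed.

Lemma has_sumS (a : nat -> R) (l : R) :
  has_sum a l -> has_sum (fun n => a n.+1) (l - a 0%N).
Proof.
move=> h; pose a' n := if n == 0%N then 0 else a n.
have h' : has_sum a' (l - a 0%N).
  have h0 : has_sum (fun n => if n == 0%N then a n else 0) (a 0%N).
    by apply: (@has_sum1 _ (fun n => if n == 0%N then a n else 0) 0%N) => n /negbTE->.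
  apply: (eq_has_sum _ (has_sumB h h0)) => n.
  by rewrite /a'; case: ifP => _; rewrite ?subrr ?subr0.
apply: (@has_sum_inj _ _ succn predn a' _ _ _ h') => //.
by case=> //=; rewrite /a' eqxx eqxx.
Qed.

Lemma bsum_geometric (a : R) : 0 <= a -> bsum (fun n => a * (2^-1) ^+ n) (2 * a).
Proof.
move=> a0 J.
have [M hM] : exists M, forall i, i \in J -> (i < M)%N.
  exists (\sum_(i <- J) i).+1 => i iJ.
  by rewrite ltnS (big_fsetD1 i)//= leq_addr.
have sub : (J `<=` [fset i | i in iota 0 M])%fset.
  by apply/fsubsetP => i /hM iM; rewrite !inE /= mem_iota.
have le : \sum_(i <- J) `|a * (2^-1) ^+ i| <= \sum_(i < M) a * (2^-1) ^+ i.
  rewrite -(big_mkord xpredT (fun i => a * (2^-1) ^+ i)) /index_iota subn0.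
  have -> : \sum_(i <- iota 0 M) a * (2^-1) ^+ i =
    \sum_(i <- [fset i | i in iota 0 M]%fset) a * (2^-1) ^+ i.
    by rewrite big_imfset //= undup_id ?iota_uniq.
  rewrite [leRHS](big_fset_sub _ sub) -[leLHS]addr0 lerD //; last first.
    by apply: sumr_ge0 => i _; rewrite mulr_ge0// exprn_ge0// invr_ge0.
  by apply: ler_sum => i _; rewrite ger0_norm// mulr_ge0// exprn_ge0// invr_ge0.
apply: (le_trans le).
suff -> : \sum_(i < M) a * (2^-1) ^+ i = 2 * a - 2 * a * 2^-1 ^+ M.
  by rewrite gerBl mulr_ge0 ?exprn_ge0 ?invr_ge0// mulr_ge0.
elim: M {hM sub le} => [|k IH]; first by rewrite big_ord0 expr0; lra.
by rewrite big_ord_recr /= IH exprS; lra.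
Qed.

End Sums.
Arguments has_sumZ [R I c l] a _.
Arguments bsumZ [R I c N] a _.

(** * Weighted power series *)

Section Monomials.
Variables (R : realType) (n : nat).

Implicit Types (m : {ffun 'I_n -> nat}) (x : 'rV[R]_n).

Definition mdeg (m : {ffun 'I_n -> nat}) : nat := (\sum_(i < n) m i)%N.
Definition mi0 : {ffun 'I_n -> nat} := [ffun=> 0%N].
Definition munit (i : 'I_n) : {ffun 'I_n -> nat} := [ffun j => nat_of_bool (j == i)].
Definition madd (m m' : {ffun 'I_n -> nat}) : {ffun 'I_n -> nat} :=
  [ffun i => (m i + m' i)%N].
Definition msub (m m' : {ffun 'I_n -> nat}) : {ffun 'I_n -> nat} :=
  [ffun i => (m i - m' i)%N].
Definition mon (x : 'rV[R]_n) (m : {ffun 'I_n -> nat}) : R :=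
  \prod_(i < n) x 0 i ^+ m i.

Lemma mdeg0 : mdeg mi0 = 0%N.
Proof. by rewrite /mdeg big1// => i _; rewrite ffunE. Qed.

Lemma mdegU i : mdeg (munit i) = 1%N.
Proof.
rewrite /mdeg (bigD1 i)//= ffunE eqxx big1// => j /negbTE.
by rewrite ffunE => ->.
Qed.

Lemma mdegD m m' : mdeg (madd m m') = (mdeg m + mdeg m')%N.
Proof. by rewrite /mdeg -big_split; apply: eq_bigr => i _; rewrite ffunE. Qed.

Lemma leq_mdeg m i : (m i <= mdeg m)%N.
Proof. by rewrite /mdeg (bigD1 i)//= leq_addr. Qed.

Lemma leq_mdeg2 m i j : i != j -> (m i + m j <= mdeg m)%N.
Proof.
by move=> ij; rewrite /mdeg (bigD1 i)//= (bigD1 j) 1?eq_sym//= addnA leq_addr.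
Qed.

Lemma mdeg_eq0 m : (mdeg m == 0%N) = (m == mi0).
Proof.
apply/eqP/eqP => [h|->]; last exact: mdeg0.
by apply/ffunP => i; rewrite ffunE; apply/eqP; rewrite -leqn0 -h leq_mdeg.
Qed.

Lemma msubK m i : m i != 0%N -> madd (msub m (munit i)) (munit i) = m.
Proof.
move=> mi; apply/ffunP => j; rewrite !ffunE; case: eqVneq => [->|_].
  by rewrite subnK// lt0n.
by rewrite subn0 addn0.
Qed.

Lemma maddK m i : msub (madd m (munit i)) (munit i) = m.
Proof. by apply/ffunP => j; rewrite !ffunE addnK. Qed.

Lemma maddI m m' m'' : madd m m'' = madd m' m'' -> m = m'.
Proof.
move=> /ffunP h; apply/ffunP => j; have := h j; rewrite !ffunE.
exact: addIn.
Qed.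

Lemma mi_ind (P : {ffun 'I_n -> nat} -> Prop) :
  P mi0 -> (forall m i, P m -> P (madd m (munit i))) -> forall m, P m.
Proof.
move=> P0 PS m; have [k] := ubnP (mdeg m); elim: k m => // k IH m.
rewrite ltnS => mk; have [->//|m0] := eqVneq m mi0.
have [i mi] : exists i, m i != 0%N.
  apply/existsP; apply: contraNT m0; rewrite negb_exists => /forallP h.
  by apply/eqP/ffunP => i; have := h i; rewrite negbK ffunE => /eqP.
rewrite -(msubK mi); apply: PS; apply: IH.
by rewrite -(msubK mi) mdegD mdegU addn1 in mk.
Qed.

Lemma mon0 x : mon x mi0 = 1.
Proof. by rewrite /mon big1// => i _; rewrite ffunE expr0. Qed.

Lemma monU x i : mon x (munit i) = x 0 i.
Proof.
rewrite /mon (bigD1 i)//= ffunE eqxx expr1 big1 ?mulr1// => j /negbTE.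
by rewrite ffunE => ->; rewrite expr0.
Qed.

Lemma monD x m m' : mon x (madd m m') = mon x m * mon x m'.
Proof.
by rewrite /mon -big_split; apply: eq_bigr => i _; rewrite ffunE exprD.
Qed.

Lemma normr_mon_le (x : 'rV[R]_n) (s : R) m :
  (forall i, `|x 0 i| <= s) -> `|mon x m| <= s ^+ mdeg m.
Proof.
move=> xs; rewrite /mon normr_prod /mdeg expr_sum.
apply: ler_prod => i _; rewrite normr_ge0 normrX /=.
by rewrite lerXn2r// nnegrE// (le_trans _ (xs i)).
Qed.

End Monomials.
Arguments mi0 {n}.
Arguments munit {n} i.

Section Weights.
Variables (R : realType) (n : nat).
Implicit Types (w : {ffun 'I_n -> nat} -> R) (f g : 'rV[R]_n -> R).

Definition weight w : Prop :=
  [/\ w mi0 = 1, forall m, 0 < w m & forall m m', w (madd m m') <= w m * w m'].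

Definition iso_weight (rho : R) (m : {ffun 'I_n -> nat}) : R := rho ^+ mdeg m.

(** The points at which finite weighted l^1 norm guarantees absolute convergence. For the isotropic
    weight this is the closed ball of radius [rho] in the maximum norm. *)
Definition wdom w (x : 'rV[R]_n) : Prop := forall m, `|mon x m| <= w m.

(** The coefficients are hidden, so norm estimates can be chained directly on functions; [f] is
    constrained only on [wdom w]. *)
Definition wexp w (N : R) f : Prop :=
  exists2 c : {ffun 'I_n -> nat} -> R, bsum (fun m => c m * w m) N &
    forall x, wdom w x -> has_sum (fun m => c m * mon x m) (f x).

Lemma iso_weightP rho : 0 < rho -> weight (iso_weight rho).
Proof.
move=> r0; split=> [|m|m m']; rewrite /iso_weight ?mdeg0 ?expr0//.
  by rewrite exprn_gt0.
by rewrite mdegD exprD.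
Qed.

Lemma wdom_iso rho (x : 'rV[R]_n) :
  (forall i, `|x 0 i| <= rho) -> wdom (iso_weight rho) x.
Proof. by move=> h m; exact: normr_mon_le. Qed.

Lemma wdom_bsum w c N x : wdom w x -> bsum (fun m => c m * w m) N ->
  bsum (fun m => c m * mon x m) N.
Proof.
move=> wx; apply: bsum_le => // m; rewrite !normrM ler_wpM2l//.
exact: (le_trans (wx m) (ler_norm _)).
Qed.

Lemma wexp_bound w N f x : wexp w N f -> wdom w x -> `|f x| <= N.
Proof.
move=> [c cN cf] wx; exact: (has_sum_norm_le (wdom_bsum wx cN) (cf x wx)).
Qed.

Lemma wexp_ge0 w N f : wexp w N f -> 0 <= N.
Proof. by move=> [c /bsum_ge0]. Qed.

Lemma wexp_le w w' N N' f : (forall m, 0 <= w' m) -> (forall m, w' m <= w m) ->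
  N <= N' -> wexp w N f -> wexp w' N' f.
Proof.
move=> w'0 w'w NN' [c cN cf]; exists c.
  apply: (bsum_le _ NN' cN) => m; rewrite !normrM ler_wpM2l//.
  by rewrite ger0_norm// (le_trans (w'w m))// ler_norm.
by move=> x wx; apply: cf => m; exact: le_trans (wx m) (w'w m).
Qed.

Lemma eq_wexp w N f g : (forall x, wdom w x -> f x = g x) ->
  wexp w N f -> wexp w N g.
Proof. by move=> fg [c cN cf]; exists c => // x wx; rewrite -fg//; exact: cf. Qed.

Lemma wexp_coef1 w (a : R) m0 : (forall m, 0 < w m) ->
  wexp w (`|a| * w m0) (fun x => a * mon x m0).
Proof.
move=> wp; exists (fun m => if m == m0 then a else 0).
  move=> J; have [mJ|mJ] := boolP (m0 \in J); last first.
    rewrite big_seq big1; first by rewrite mulr_ge0// ltW.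
    by move=> m; case: eqP => [->|]; rewrite ?(negbTE mJ)// mul0r normr0.
  rewrite (big_fsetD1 m0)//= eqxx big_seq big1 ?addr0.
    by rewrite normrM (gtr0_norm (wp _)).
  by move=> m; rewrite !inE => /andP[/negbTE-> _]; rewrite mul0r normr0.
move=> x _.
have := @has_sum1 _ _ (fun m => (if m == m0 then a else 0) * mon x m) m0.
by rewrite eqxx; apply=> m /negbTE->; rewrite mul0r.
Qed.

Lemma wexp_cst w a : weight w -> wexp w `|a| (fun=> a).
Proof.
move=> [w0 wp _]; have := wexp_coef1 a mi0 wp; rewrite w0 mulr1.
by apply: eq_wexp => x _; rewrite mon0 mulr1.
Qed.

Lemma wexp_coord w i : weight w -> wexp w (w (munit i)) (fun x => x 0 i).
Proof.
move=> [w0 wp _]; have := wexp_coef1 1 (munit i) wp; rewrite normr1 mul1r.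
by apply: eq_wexp => x _; rewrite monU mul1r.
Qed.

Lemma wexpD w N M f g : wexp w N f -> wexp w M g ->
  wexp w (N + M) (fun x => f x + g x).
Proof.
move=> [c cN cf] [d dM dg]; exists (fun m => c m + d m).
  by apply: (eq_bsum _ (bsumD cN dM)) => m; rewrite mulrDl.
move=> x wx; apply: (eq_has_sum _ (has_sumD (cf x wx) (dg x wx))) => m.
by rewrite mulrDl.
Qed.

Lemma wexpZ w N f a : wexp w N f -> wexp w (`|a| * N) (fun x => a * f x).
Proof.
move=> [c cN cf]; exists (fun m => a * c m).
  by apply: (eq_bsum _ (bsumZ a cN)) => m; rewrite mulrA.
move=> x wx; apply: (eq_has_sum _ (has_sumZ a (cf x wx))) => m.
by rewrite mulrA.
Qed.

Lemma wexp_sum w (K : Type) (r : seq K) (P : pred K) (N : K -> R)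
    (f : K -> 'rV[R]_n -> R) : weight w ->
  (forall k, P k -> wexp w (N k) (f k)) ->
  wexp w (\sum_(k <- r | P k) N k) (fun x => \sum_(k <- r | P k) f k x).
Proof.
move=> ww h; elim: r => [|k r IH].
  rewrite big_nil; have := wexp_cst 0 ww; rewrite normr0.
  by apply: eq_wexp => x _; rewrite big_nil.
rewrite big_cons; case: ifP => Pk.
  by apply: (eq_wexp _ (wexpD (h _ Pk) IH)) => x _; rewrite big_cons Pk.
by apply: (eq_wexp _ IH) => x _; rewrite big_cons Pk.
Qed.

(** Collecting like terms in a sum of monomials over an arbitrary index type. Each collected
    coefficient converges because the single value [w m] is positive; [key] is then used once with
    the weights and once with the monomials at a point. *)
Lemma wexp_collect w (T : choiceType) (k : T -> R) (s : T -> {ffun 'I_n -> nat})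
    (N : R) f : (forall m, 0 < w m) -> bsum (fun t => k t * w (s t)) N ->
  (forall x, wdom w x -> has_sum (fun t => k t * mon x (s t)) (f x)) ->
  wexp w N f.
Proof.
move=> wp b h.
have ex m : exists l, has_sum (fun t => k t *+ (s t == m)) l.
  apply: (@bsum_has_sum _ _ _ (`|(w m)^-1| * N)).
  apply: (bsum_le _ (lexx _) (bsumZ (w m)^-1 b)) => t.
  case: eqVneq => [->|_]; last by rewrite mulr0n normr0.
  by rewrite mulrCA mulVf ?mulr1// gt_eqF.
have [c hc] := choice ex.
have key (v : {ffun 'I_n -> nat} -> R) : forall m,
    has_sum (fun t => (k t * v (s t)) *+ (s t == m)) (c m * v m).
  move=> m; rewrite mulrC; apply: (eq_has_sum _ (has_sumZ (v m) (hc m))) => t.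
  by case: eqVneq => [->|_]; rewrite ?mulr1n 1?mulrC// !mulr0n mul0r.
exists c; first by have [] := has_sum_fibre b (key w).
move=> x wx.
have bx : bsum (fun t => k t * mon x (s t)) N.
  apply: (bsum_le _ (lexx _) b) => t; rewrite !normrM ler_wpM2l//.
  exact: (le_trans (wx _) (ler_norm _)).
have [_ ] := has_sum_fibre bx (key (mon x)).
by apply; exact: h.
Qed.

(** The Cauchy product: the products of coefficients are indexed by pairs and collected at the sum
    of the two multi-indices. Submultiplicativity of the weight is what makes the l^1 norm an
    algebra norm. *)
Lemma wexpM w N M f g : weight w -> wexp w N f -> wexp w M g ->
  wexp w (N * M) (fun x => f x * g x).
Proof.
move=> [_ wp wM] [c cN cf] [d dM dg].
have pairb (u v : {ffun 'I_n -> nat} -> R) : bsum u N -> bsum v M ->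
    bsum (fun t => u t.1 * v t.2) (N * M).
  move=> uN vM; apply: (bsum_pair (N_ := fun m => `|u m| * M)).
    by move=> m; exact: (bsumZ (u m) vM).
  rewrite mulrC; have := bsumZ M uN; rewrite (ger0_norm (bsum_ge0 vM)).
  apply: bsum_le => // m; rewrite normrM normr_id.
  by rewrite [leRHS]normrM mulrC.
apply: (@wexp_collect w _ (fun t => c t.1 * d t.2) (fun t => madd t.1 t.2)) => //.
  apply: (bsum_le _ (lexx _) (pairb _ _ cN dM)) => -[m m'] /=.
  rewrite [X in _ <= `|X|]mulrACA !normrM ler_wpM2l ?mulr_ge0//.
  by rewrite !gtr0_norm.
move=> x wx.
have b := pairb _ _ (wdom_bsum wx cN) (wdom_bsum wx dM).
have [S hS] := bsum_has_sum b.
have [] := has_sum_pair b hS (r := fun m => (c m * mon x m) * g x).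
  by move=> m /=; apply: has_sumZ; exact: dg.
move=> _ h; have h' := has_sumZ (g x) (cf x wx).
have : S = g x * f x.
  apply: (has_sum_unique h); apply: (eq_has_sum _ h') => m.
  by rewrite mulrC.
rewrite mulrC => e; rewrite -e; apply: (eq_has_sum _ hS) => -[m m'] /=.
by rewrite monD mulrACA.
Qed.

Lemma wexpX w N f k : weight w -> wexp w N f ->
  wexp w (N ^+ k) (fun x => f x ^+ k).
Proof.
move=> ww h; elim: k => [|k IH].
  rewrite expr0; have := wexp_cst 1 ww; rewrite normr1.
  by apply: eq_wexp => x _; rewrite expr0.
by rewrite exprS; apply: (eq_wexp _ (wexpM ww h IH)) => x _; rewrite exprS.
Qed.

Lemma wexp_prod w (K : Type) (r : seq K) (N : K -> R)
    (f : K -> 'rV[R]_n -> R) : weight w ->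
  (forall k, wexp w (N k) (f k)) ->
  wexp w (\prod_(k <- r) N k) (fun x => \prod_(k <- r) f k x).
Proof.
move=> ww h; elim: r => [|k r IH].
  rewrite big_nil; have := wexp_cst 1 ww; rewrite normr1.
  by apply: eq_wexp => x _; rewrite big_nil.
rewrite big_cons.
by apply: (eq_wexp _ (wexpM ww (h k) IH)) => x _; rewrite big_cons.
Qed.

(** A norm-convergent series of power series may be summed coefficientwise, by exchanging two
    absolutely convergent sums. It is stated for coefficients, not functions, because the operators
    iterated later act on coefficients. *)
Lemma coef_series w (K : choiceType) (c : K -> {ffun 'I_n -> nat} -> R)
    (d : {ffun 'I_n -> nat} -> R) (N_ : K -> R) (N : R) :
  (forall m, 0 < w m) ->
  (forall k, bsum (fun m => c k m * w m) (N_ k)) -> bsum N_ N ->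
  (forall m, has_sum (fun k => c k m) (d m)) ->
  bsum (fun m => d m * w m) N /\
  forall x r, wdom w x -> (forall k, has_sum (fun m => c k m * mon x m) (r k)) ->
    exists2 S, has_sum r S & has_sum (fun m => d m * mon x m) S.
Proof.
move=> wp cN bN hd.
have key (v : {ffun 'I_n -> nat} -> R) :
    (forall k, bsum (fun m => c k m * v m) (N_ k)) ->
    bsum (fun m => d m * v m) N /\
    forall r, (forall k, has_sum (fun m => c k m * v m) (r k)) ->
    exists2 S, has_sum r S & has_sum (fun m => d m * v m) S.
  move=> bv.
  have b := bsum_pair (c := fun t => c t.1 t.2 * v t.2) bv bN.
  have [S hS] := bsum_has_sum b.
  have [] := has_sum_pair (bsum_swap b) (has_sum_swap hS)
    (r := fun m => d m * v m).
    move=> m /=; rewrite mulrC; apply: (eq_has_sum _ (has_sumZ (v m) (hd m))) => k.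
    by rewrite mulrC.
  move=> b1 h1; split=> // r hr; exists S => //.
  by have [] := has_sum_pair b hS hr.
split; first by have [] := key w cN.
move=> x r wx; have [_] := key (mon x) (fun k => wdom_bsum wx (cN k)).
exact.
Qed.

Lemma coef_series_ex w (K : choiceType) (c : K -> {ffun 'I_n -> nat} -> R)
    (N_ : K -> R) (N : R) :
  (forall m, 0 < w m) ->
  (forall k, bsum (fun m => c k m * w m) (N_ k)) -> bsum N_ N ->
  exists d, forall m, has_sum (fun k => c k m) (d m).
Proof.
move=> wp cN bN; suff /choice[d hd] : forall m, exists l, has_sum (fun k => c k m) l.
  by exists d.
move=> m.
apply: (@bsum_has_sum _ _ _ ((w m)^-1 * N)).
have := bsumZ (w m)^-1 bN; rewrite gtr0_norm ?invr_gt0//.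
apply: bsum_le => // k; rewrite normrM gtr0_norm ?invr_gt0// mulrC.
rewrite ler_pdivlMr// -(gtr0_norm (wp m)) -normrM.
have := cN k [fset m]%fset; rewrite big_seq_fset1 => /le_trans; apply.
exact: ler_norm.
Qed.

Lemma wexp_series w (K : choiceType) (f : K -> 'rV[R]_n -> R) g (N_ : K -> R)
    (N : R) : (forall m, 0 < w m) ->
  (forall k, wexp w (N_ k) (f k)) -> bsum N_ N ->
  (forall x, wdom w x -> has_sum (fun k => f k x) (g x)) ->
  wexp w N g.
Proof.
move=> wp h bN hg.
have /choice[c hc] : forall k, exists c : {ffun 'I_n -> nat} -> R,
    bsum (fun m => c m * w m) (N_ k) /\
    forall x, wdom w x -> has_sum (fun m => c m * mon x m) (f k x).
  by move=> k; have [c h1 h2] := h k; exists c.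
have [d hd] := coef_series_ex wp (fun k => (hc k).1) bN.
have [b1 b2] := coef_series wp (fun k => (hc k).1) bN hd.
exists d => // x wx; have [S hS] := b2 x _ wx (fun k => (hc k).2 x wx).
by rewrite (has_sum_unique (hg x wx) hS).
Qed.

End Weights.
Arguments weight {R n} w.
Arguments wdom {R n} w x.
Arguments wexp {R n} w N f.
Arguments iso_weight {R n} rho m.

(** * Analytic functions *)

Section Analytic.
Variable R : realType.

Lemma rV_norm_le (n : nat) (x : 'rV[R]_n) (s : R) :
  0 <= s -> (`|x| <= s <-> forall i, `|x 0 i| <= s).
Proof.
move=> s0; rewrite [X in X <= _]mx_normrE; split=> [h i|h].
  apply: (le_trans _ h).
  exact: (le_bigmax_cond _ (fun ij => `|x ij.1 ij.2|) (j := (0, i))).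
by apply: bigmax_le => // -[i j] _ /=; rewrite (ord1 i).
Qed.

Lemma rV_coord_le (n : nat) (x : 'rV[R]_n) i : `|x 0 i| <= `|x|.
Proof. by apply: (rV_norm_le x (normr_ge0 x)).1. Qed.

Lemma wdom_isoE (n : nat) (rho : R) (x : 'rV[R]_n) : 0 <= rho ->
  wdom (iso_weight rho) x <-> `|x| <= rho.
Proof.
move=> r0; split=> [h|/(rV_norm_le x r0) h]; last exact: wdom_iso.
by apply/rV_norm_le => // i; have := h (munit i);
  rewrite monU /iso_weight mdegU expr1.
Qed.

Lemma wexp_iso_le (n : nat) (rho rho' N : R) (f : 'rV[R]_n -> R) :
  0 <= rho' -> rho' <= rho -> wexp (iso_weight rho) N f ->
  wexp (iso_weight rho') N f.
Proof.
move=> r0 rr; apply: wexp_le => // m; rewrite /iso_weight ?exprn_ge0//.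
by apply: lerXn2r; rewrite // nnegrE// (le_trans r0).
Qed.

(** At the point whose coordinates all equal [r / 2] the monomials are exactly the isotropic
    weights, so convergence at this one point, being absolute, bounds the norm. *)
Lemma analytic_wexp (n : nat) (f : 'rV[R]_n -> R) (a : 'rV[R]_n) :
  analytic_fun_at f a <->
  exists rho N, 0 < rho /\ wexp (iso_weight rho) N (fun x => f (a + x)).
Proof.
split=> [[c [r [r0 h]]]|[rho [N [r0 [c cN cf]]]]]; last first.
  exists c, rho; split=> // x xa.
  have wx : wdom (iso_weight rho) (x - a) by apply/wdom_isoE; rewrite ltW.
  have := cf _ wx; rewrite addrCA subrr addr0.
  apply: eq_has_sum => m; congr (_ * _); apply: eq_bigr => i _.
  by rewrite !mxE.
have hx (x : 'rV[R]_n) : `|x| < r -> has_sum (fun m => c m * mon x m) (f (a + x)).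
  move=> xr; have := h (a + x); rewrite addrC addKr => /(_ xr).
  apply: eq_has_sum => m; congr (_ * _); apply: eq_bigr => i _.
  by rewrite mxE addrAC subrr add0r.
have r20 : 0 < r / 2 by lra.
have [N bN] : exists N, bsum (fun m => c m * iso_weight (r / 2) m) N.
  have /hx/has_sum_bounded[N bN] : `|const_mx (r / 2) : 'rV[R]_n| < r.
    apply: (@le_lt_trans _ _ (r / 2)); last lra.
    by apply/rV_norm_le => [|i]; rewrite ?mxE ?gtr0_norm// ltW.
  exists N; apply: (eq_bsum _ bN) => m; congr (_ * _).
  by rewrite /mon /iso_weight /mdeg expr_sum; apply: eq_bigr => i _; rewrite mxE.
exists (r / 2), N; split=> //; exists c => // x /wdom_isoE xr; apply: hx.
by rewrite (le_lt_trans (xr _))//; lra.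
Qed.

Lemma analytic_near_eq (n : nat) (f g : 'rV[R]_n -> R) (a : 'rV[R]_n) (e : R) :
  0 < e -> (forall x, `|x - a| < e -> f x = g x) ->
  analytic_fun_at f a -> analytic_fun_at g a.
Proof.
move=> e0 fg [c [r [r0 h]]]; exists c, (Num.min r e).
by rewrite lt_min r0 e0; split=> // x; rewrite lt_min => /andP[xr xe];
  rewrite -fg//; exact: h.
Qed.

(** In a normed algebra a power series may be evaluated at elements whose norm does not exceed its
    radius. The norm of the result stays bounded by that of the outer series. *)
Lemma wexp_comp (n k : nat) (w : {ffun 'I_k -> nat} -> R) (r N : R)
    (f : 'rV[R]_n -> R) (h : 'I_n -> 'rV[R]_k -> R) :
  weight w -> 0 <= r -> wexp (iso_weight r) N f -> (forall i, wexp w r (h i)) ->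
  wexp w N (fun x => f (\row_i h i x)).
Proof.
move=> ww r0 [c cN cf] hh.
apply: (@wexp_series _ _ w _ (fun m x => c m * \prod_i h i x ^+ m i) _
  (fun m => `|c m| * \prod_i r ^+ m i)).
- by case: ww.
- move=> m; apply: wexpZ.
  apply: (@wexp_prod _ _ w _ _ (fun i => r ^+ m i) (fun i x => h i x ^+ m i)) => //.
  by move=> i; exact: wexpX.
- apply: bsum_le cN => // m; rewrite /iso_weight /mdeg expr_sum.
  by rewrite !normrM normr_id.
move=> x wx; have wr : wdom (iso_weight r) (\row_i h i x).
  by apply: wdom_iso => i; rewrite mxE; exact: wexp_bound (hh i) wx.
apply: (eq_has_sum _ (cf _ wr)) => m; congr (_ * _); apply: eq_bigr => i _.
by rewrite mxE.
Qed.

(** Without a constant term every monomial has degree at least 1, so scaling the radius by [t <= 1]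
    scales the norm by at most [t]. *)
Lemma wexp_small (n : nat) (rho N e : R) (h : 'rV[R]_n -> R) :
  0 < rho -> wexp (iso_weight rho) N h -> h 0 = 0 -> 0 < e ->
  exists2 rho', 0 < rho' <= rho & wexp (iso_weight rho') e h.
Proof.
move=> r0 hN h0 e0; have N0 := wexp_ge0 hN; case: hN => c cN ch.
have c0 : c mi0 = 0.
  have d0 : wdom (iso_weight rho) (0 : 'rV[R]_n).
    by apply/wdom_isoE; rewrite ?normr0 ltW.
  have h1 : has_sum (fun m => c m * mon 0 m) (c mi0 * mon (0 : 'rV[R]_n) mi0).
    apply: (@has_sum1 _ _ (fun m => c m * mon 0 m)) => m m0.
    apply/eqP; rewrite mulf_eq0 -[mon 0 m == 0]normr_le0 orbC.
    rewrite (le_trans (normr_mon_le (s := 0) m _))//.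
      by move=> i; rewrite mxE normr0.
    by rewrite expr0n mdeg_eq0 (negbTE m0).
  by have := has_sum_unique (ch _ d0) h1; rewrite h0 mon0 mulr1 => <-.
(* The added 1 keeps the denominator positive when [N] is zero. *)
pose t := Num.min 1 (e / (N + 1)).
have t0 : 0 < t by rewrite lt_min ltr01 divr_gt0//; lra.
have t1 : t <= 1 by rewrite ge_min lexx.
have tN : t * N <= e.
  apply: (@le_trans _ _ (e / (N + 1) * N)).
    by apply: ler_wpM2r => //; rewrite ge_min lexx orbT.
  by rewrite mulrAC ler_pdivrMr ?ler_pM2l//; lra.
have tr : 0 < t * rho <= rho by rewrite mulr_gt0//= ler_piMl// ltW.
exists (t * rho) => //; exists c; last first.
  move=> x /wdom_isoE xr; apply: ch; apply/wdom_isoE; first exact: ltW.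
  by case/andP: tr => ? ?; rewrite (le_trans (xr _))// ltW.
apply: bsum_le tN _; last first.
  by have := bsumZ t cN; rewrite gtr0_norm//; exact.
move=> m; have [->|m0] := eqVneq m mi0; first by rewrite c0 !(mul0r, mulr0).
rewrite /iso_weight exprMn mulrCA !normrM ler_wpM2r ?mulr_ge0//.
rewrite (ger0_norm (ltW t0)) ger0_norm ?exprn_ge0 ?(ltW t0)//.
have : (0 < mdeg m)%N by rewrite lt0n mdeg_eq0.
case: (mdeg m) => // k _; rewrite exprS ler_piMr ?(ltW t0)//.
by rewrite exprn_ile1// ltW.
Qed.

Lemma common_radius (T : finType) (P : T -> R -> Prop) :
  (forall t r r', 0 < r' -> r' <= r -> P t r -> P t r') ->
  (forall t, exists2 r, 0 < r & P t r) ->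
  exists2 r, 0 < r & forall t, P t r.
Proof.
move=> mono h; have /choice[r hr] : forall t, exists r, 0 < r /\ P t r.
  by move=> t; have [r r0 Pr] := h t; exists r.
have m0 : 0 < \big[Num.min/1]_t r t by apply: lt_bigmin => // t _; exact: (hr t).1.
exists (\big[Num.min/1]_t r t) => // t; apply: mono m0 _ (hr t).2.
exact: bigmin_le_cond.
Qed.

Lemma analytic_comp (n k : nat) (f : 'rV[R]_n -> R) (g : 'rV[R]_k -> 'rV[R]_n)
    (a : 'rV[R]_k) (b : 'rV[R]_n) :
  g a = b -> analytic_fun_at f b -> analytic_at g a ->
  analytic_fun_at (f \o g) a.
Proof.
move=> gab /analytic_wexp[r [N [r0 fN]]] ga.
have [rho rho0 hh] : exists2 rho, 0 < rho & forall i,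
    wexp (iso_weight rho) r (fun x => g (a + x) 0 i - b 0 i).
  apply: (@common_radius _ (fun i rho =>
    wexp (iso_weight rho) r (fun x => g (a + x) 0 i - b 0 i))).
    by move=> i s s' s0 ss; apply: wexp_iso_le => //; exact: ltW.
  move=> i; have /analytic_wexp[s [M [s0 hM]]] := ga i.
  have hM' := wexpD hM (wexp_cst (- b 0 i) (iso_weightP k s0)).
  have [|s' /andP[s'0 _] h'] := wexp_small s0 hM' _ r0.
    by rewrite addr0 gab subrr.
  by exists s'.
apply/analytic_wexp; exists rho, N; split=> //.
have := wexp_comp (iso_weightP k rho0) (ltW r0) fN hh.
apply: eq_wexp => x _ /=; congr f; apply/rowP => i; rewrite !mxE.
by rewrite addrC subrK.
Qed.

(** Re-expansion at [y] is composition with a translation: in radius [s] the coordinates of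
    [(y - a) + x] have norm at most [|y - a| + s], which equals [r]. *)
Lemma analytic_open (n : nat) (f : 'rV[R]_n -> R) (a : 'rV[R]_n) :
  analytic_fun_at f a ->
  exists2 r, 0 < r & forall y, `|y - a| < r -> analytic_fun_at f y.
Proof.
move=> /analytic_wexp[r [N [r0 fN]]]; exists r => // y ya.
pose s := r - `|y - a|; have s0 : 0 < s by rewrite /s; lra.
apply/analytic_wexp; exists s, N; split=> //.
have ww := iso_weightP n s0.
have h i : wexp (iso_weight s) r (fun x : 'rV[R]_n => (y - a) 0 i + x 0 i).
  have := wexpD (wexp_cst ((y - a) 0 i) ww) (wexp_coord i ww).
  apply: wexp_le => // [m|]; first by rewrite exprn_ge0 ?ltW.
  rewrite /iso_weight mdegU expr1 /s; have := rV_coord_le (y - a) i; lra.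
have := wexp_comp ww (ltW r0) fN h.
apply: eq_wexp => x _ /=; congr f; apply/rowP => i; rewrite !mxE.
by ring.
Qed.

Lemma analytic_cst (n : nat) (v : R) (a : 'rV[R]_n) :
  analytic_fun_at (fun=> v) a.
Proof.
apply/analytic_wexp; exists 1, `|v|; split=> //.
exact/wexp_cst/iso_weightP.
Qed.

Lemma analytic_op2 (n : nat) (op : R -> R -> R) (f g : 'rV[R]_n -> R) a :
  (forall w N M (f g : 'rV[R]_n -> R), weight w -> wexp w N f -> wexp w M g ->
    exists K, wexp w K (fun x => op (f x) (g x))) ->
  analytic_fun_at f a -> analytic_fun_at g a ->
  analytic_fun_at (fun x => op (f x) (g x)) a.
Proof.
move=> hop /analytic_wexp[r [N [r0 fN]]] /analytic_wexp[s [M [s0 gM]]].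
pose t := Num.min r s; have t0 : 0 < t by rewrite lt_min r0.
have tr : t <= r by rewrite ge_min lexx.
have ts : t <= s by rewrite ge_min lexx orbT.
have fN' := wexp_iso_le (ltW t0) tr fN.
have gM' := wexp_iso_le (ltW t0) ts gM.
have [K hK] := hop _ _ _ _ _ (iso_weightP n t0) fN' gM'.
by apply/analytic_wexp; exists t, K.
Qed.

Lemma analyticD (n : nat) (f g : 'rV[R]_n -> R) a :
  analytic_fun_at f a -> analytic_fun_at g a ->
  analytic_fun_at (fun x => f x + g x) a.
Proof.
apply: analytic_op2 => w N M f' g' _ fN gM; exists (N + M); exact: wexpD.
Qed.

Lemma analyticM (n : nat) (f g : 'rV[R]_n -> R) a :
  analytic_fun_at f a -> analytic_fun_at g a ->
  analytic_fun_at (fun x => f x * g x) a.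
Proof.
apply: analytic_op2 => w N M f' g' ww fN gM; exists (N * M); exact: wexpM.
Qed.

Lemma analyticN (n : nat) (f : 'rV[R]_n -> R) a :
  analytic_fun_at f a -> analytic_fun_at (fun x => - f x) a.
Proof.
move=> fa; have := analyticM (analytic_cst (-1) a) fa.
by apply: (analytic_near_eq ltr01) => x _; rewrite mulN1r.
Qed.

Lemma has_sum_geometric (h : R) : `|h| <= 2^-1 ->
  has_sum (fun k => h ^+ k) (1 - h)^-1.
Proof.
move=> h2.
have b : bsum (fun k => h ^+ k) 2.
  have := bsum_geometric (@ler01 R); rewrite mulr1; apply: bsum_le => // k.
  rewrite normrX mul1r [leRHS]ger0_norm ?exprn_ge0 ?invr_ge0//.
  by rewrite lerXn2r// nnegrE ?invr_ge0.
have [S hS] := bsum_has_sum b.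
have := has_sumS hS; rewrite expr0 => hS1.
have hS2 : has_sum (fun k => h ^+ k.+1) (h * S).
  by apply: (eq_has_sum _ (has_sumZ h hS)) => k; rewrite exprS.
have e := has_sum_unique hS1 hS2.
suff -> : (1 - h)^-1 = S by [].
have h1 : 1 - h != 0.
  rewrite subr_eq0; apply: contraTneq h2 => <-.
  by rewrite normr1 -ltNge invf_lt1 ?ltr1n.
apply: (mulfI h1); rewrite divff//; lra.
Qed.

Lemma analyticV (n : nat) (f : 'rV[R]_n -> R) a :
  f a != 0 -> analytic_fun_at f a -> analytic_fun_at (fun x => (f x)^-1) a.
Proof.
move=> fa0 /analytic_wexp[r [N [r0 fN]]].
(* The function [1 - f / f a] vanishes at the base point, so its norm can be brought below 1/2,
   where the geometric series inverts [f / f a]. *)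
have hN := wexpD (wexp_cst 1 (iso_weightP n r0)) (wexpZ (- (f a)^-1) fN).
have [||s /andP[s0 _] hs] := wexp_small r0 hN _ (e := 2^-1).
- by rewrite addr0 mulNr mulVf// subrr.
- by rewrite invr_gt0.
set h := (fun x => 1 + _) in hs.
have ww := iso_weightP n s0.
apply/analytic_wexp; exists s, (`|(f a)^-1| * (2 * 1)); split=> //.
have hg : wexp (iso_weight s) (2 * 1) (fun x => (1 - h x)^-1).
  apply: (@wexp_series _ _ _ _ (fun k x => h x ^+ k) _ (fun k => 1 * 2^-1 ^+ k)).
  - by case: ww.
  - by move=> k; rewrite mul1r; exact: wexpX.
  - exact: bsum_geometric.
  by move=> x wx; apply: has_sum_geometric; exact: (wexp_bound hs).
apply: eq_wexp (wexpZ (f a)^-1 hg) => x _.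
by rewrite /h opprD addrA subrr add0r mulNr opprK invfM invrK mulrA mulVf// mul1r.
Qed.

End Analytic.

(** * Derivatives of power series *)

Section Frechet.
Variables (R : realType) (V W : normedModType R).

Lemma diff_intro (f : V -> W) (x : V) (df : {linear V -> W}) :
  continuous df ->
  (forall e : R, 0 < e -> exists2 d : R, 0 < d & forall h, `|h| < d ->
    `|f (x + h) - f x - df h| <= e * `|h|) ->
  differentiable f x /\ 'd f x = df :> (V -> W).
Proof.
move=> cdf hf.
have key : f \o shift x = cst (f x) + df +o_ 0 id.
  apply/eqaddoP => e e0; have [d d0 hd] := hf e e0.
  near=> h; have -> : (f \o shift x - (cst (f x) + df)) h =
      f (x + h) - f x - df h by rewrite /= [x + h]addrC opprD addrA.
  apply: hd; near: h; exact: nbhs0_lt.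
have dE := diff_unique cdf key.
by split=> //; apply/diff_locallyP; rewrite dE.
Unshelve. all: by end_near. Qed.

Lemma diff_elim (f : V -> W) (x : V) : differentiable f x ->
  forall e : R, 0 < e -> exists2 d : R, 0 < d & forall h, `|h| < d ->
    `|f (x + h) - f x - 'd f x h| <= e * `|h|.
Proof.
move=> /diff_locally/eqaddoP hf e e0.
have /nbhs_normP[d /= d0 hd] := hf e e0.
exists d => // h hd'; have := hd h; rewrite /= sub0r normrN => /(_ hd').
have -> : (f \o +%R^~ x - (cst (f x) + 'd f x)) h =
  f (x + h) - f x - 'd f x h by rewrite /= [x + h]addrC opprD addrA.
by [].
Qed.

Lemma diff_near_eq (f g : V -> W) (x : V) :
  (\forall y \near x, f y = g y) -> differentiable f x ->
  differentiable g x /\ 'd g x = 'd f x :> (V -> W).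
Proof.
move=> /nbhs_normP[r /= r0 fg] df; have cdf := diff_continuous df.
apply: diff_intro => // e e0; have [d d0 hd] := diff_elim df e0.
exists (Num.min d r) => [|h]; first by rewrite lt_min d0.
rewrite lt_min => /andP[hd' hr]; rewrite -!fg; first exact: hd.
  by rewrite /= subrr normr0.
by rewrite /= opprD addrA subrr add0r normrN.
Qed.

End Frechet.

Section Derivative.
Variables (R : realType) (n : nat).
Implicit Types (c : {ffun 'I_n -> nat} -> R) (x y : 'rV[R]_n).

(** The partial derivative of a monomial in direction [j]. If [m j = 0] the truncated exponent is
    harmless because the leading factor is zero. *)
Definition dmon (j : 'I_n) y (m : {ffun 'I_n -> nat}) : R :=
  (m j)%:R * mon y (msub m (munit j)).

(** The coefficients of the series differentiated termwise in direction [j]. *)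
Definition dcoef (j : 'I_n) c (m : {ffun 'I_n -> nat}) : R :=
  (m j).+1%:R * c (madd m (munit j)).

Lemma dmonD i j y m :
  dmon j y (madd m (munit i)) = (i == j)%:R * mon y m + dmon j y m * y 0 i.
Proof.
rewrite /dmon; case: (eqVneq i j) => [->|ij]; last first.
  rewrite mul0r add0r !ffunE eq_sym (negbTE ij) addn0.
  have [->|mj] := eqVneq (m j) 0%N; first by rewrite !mul0r.
  rewrite -mulrA; congr (_ * _); rewrite -monU -monD; congr (mon y _).
  apply/ffunP => k; rewrite !ffunE; case: (eqVneq k j) => [->|_].
    by rewrite eq_sym (negbTE ij) !addn0.
  by rewrite !subn0.
rewrite maddK !ffunE eqxx addn1 mul1r -natr1 mulrDl mul1r addrC; congr (_ + _).
have [->|mj] := eqVneq (m j) 0%N; first by rewrite !mul0r.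
by rewrite -mulrA -monU -monD msubK.
Qed.

Lemma sum_dmonD i y m (h : 'I_n -> R) :
  \sum_j dmon j y (madd m (munit i)) * h j =
  mon y m * h i + y 0 i * \sum_j dmon j y m * h j.
Proof.
rewrite mulr_sumr.
under eq_bigr do rewrite dmonD mulrDl.
rewrite big_split /=; congr (_ + _).
  rewrite (bigD1 i)//= eqxx mul1r big1 ?addr0// => j ji.
  by rewrite eq_sym (negbTE ji) !mul0r.
by apply: eq_bigr => j _; rewrite mulrAC mulrC mulrA.
Qed.

Lemma normr_dmon_le j y m (s : R) : (forall i, `|y 0 i| <= s) ->
  s * `|dmon j y m| <= (mdeg m)%:R * s ^+ mdeg m.
Proof.
move=> ys; have s0 : 0 <= s by rewrite (le_trans (normr_ge0 (y 0 j)))// ys.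
rewrite /dmon; have [->|mj] := eqVneq (m j) 0%N.
  by rewrite mul0r normr0 mulr0 mulr_ge0// exprn_ge0.
rewrite normrM mulrCA ger0_norm//; apply: ler_pM => //.
- by rewrite mulr_ge0.
- by rewrite ler_nat leq_mdeg.
rewrite -{2}(msubK mj) mdegD mdegU addn1 exprS ler_wpM2l//.
exact: normr_mon_le.
Qed.

(** The factor [s] on the left stands in for the exponent [mdeg m - 1] on the right, so degree zero
    needs no separate treatment and [s] is never divided by. *)
Lemma mon_lipschitz x y m (s h : R) :
  (forall i, `|x 0 i| <= s) -> (forall i, `|y 0 i| <= s) ->
  (forall i, `|x 0 i - y 0 i| <= h) -> 0 <= s -> 0 <= h ->
  s * `|mon x m - mon y m| <= (mdeg m)%:R * s ^+ mdeg m * h.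
Proof.
move=> xs ys xyh s0 h0; elim/mi_ind: m => [|m i IH].
  by rewrite !mon0 subrr normr0 mulr0 mdeg0 !mul0r.
rewrite !monD !monU mdegD mdegU addn1.
have -> : mon x m * x 0 i - mon y m * y 0 i =
  (mon x m - mon y m) * x 0 i + mon y m * (x 0 i - y 0 i) by ring.
apply: (le_trans (ler_wpM2l s0 (ler_normD _ _))); rewrite !normrM mulrDr.
have h1 : s * (`|mon x m - mon y m| * `|x 0 i|) <=
    (mdeg m)%:R * s ^+ mdeg m * h * s.
  by rewrite mulrA; apply: ler_pM => //; rewrite mulr_ge0.
have h2 : s * (`|mon y m| * `|x 0 i - y 0 i|) <= s * (s ^+ mdeg m * h).
  by apply: ler_wpM2l => //; apply: ler_pM => //; exact: normr_mon_le.
apply: (le_trans (lerD h1 h2)); rewrite le_eqVlt; apply/orP; left; apply/eqP.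
by rewrite -natr1 exprS; ring.
Qed.

(** Again [s ^+ 2] replaces a lowered exponent. Writing k for the degree, multiplication by one more
    coordinate adds a Lipschitz term k to the bound k^2, and k + k^2 <= (k + 1)^2. *)
Lemma mon_taylor x y m (s h : R) :
  (forall i, `|x 0 i| <= s) -> (forall i, `|y 0 i| <= s) ->
  (forall i, `|x 0 i - y 0 i| <= h) -> 0 <= s -> 0 <= h ->
  s ^+ 2 * `|mon x m - mon y m - \sum_j dmon j y m * (x 0 j - y 0 j)| <=
  (mdeg m)%:R ^+ 2 * s ^+ mdeg m * h ^+ 2.
Proof.
move=> xs ys xyh s0 h0; elim/mi_ind: m => [|m i IH].
  rewrite !mon0 subrr sub0r normrN big1 ?normr0 ?mulr0 ?mulr_ge0 ?exprn_ge0//.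
  by move=> j _; rewrite /dmon ffunE !mul0r.
rewrite !monD !monU mdegD mdegU addn1 sum_dmonD.
set S := \sum_j _ in IH *; set X := mon x m in IH *; set Y := mon y m in IH *.
have -> : X * x 0 i - Y * y 0 i - (Y * (x 0 i - y 0 i) + y 0 i * S) =
  (X - Y) * (x 0 i - y 0 i) + y 0 i * (X - Y - S) by ring.
have s20 : 0 <= s ^+ 2 by rewrite exprn_ge0.
apply: (le_trans (ler_wpM2l s20 (ler_normD _ _))); rewrite !normrM mulrDr.
have h1 : s ^+ 2 * (`|X - Y| * `|x 0 i - y 0 i|) <=
    s * ((mdeg m)%:R * s ^+ mdeg m * h) * h.
  have -> : s ^+ 2 * (`|X - Y| * `|x 0 i - y 0 i|) =
    s * (s * `|X - Y|) * `|x 0 i - y 0 i| by ring.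
  apply: ler_pM => //; first by rewrite !mulr_ge0.
  by apply: ler_wpM2l => //; exact: mon_lipschitz.
have h2 : s ^+ 2 * (`|y 0 i| * `|X - Y - S|) <=
    s * ((mdeg m)%:R ^+ 2 * s ^+ mdeg m * h ^+ 2).
  by rewrite mulrCA; apply: ler_pM => //; rewrite mulr_ge0.
apply: (le_trans (lerD h1 h2)).
have -> : s * ((mdeg m)%:R * s ^+ mdeg m * h) * h +
    s * ((mdeg m)%:R ^+ 2 * s ^+ mdeg m * h ^+ 2) =
  ((mdeg m)%:R + (mdeg m)%:R ^+ 2) * s ^+ (mdeg m).+1 * h ^+ 2.
  by rewrite (exprS s (mdeg m)); ring.
apply: ler_wpM2r; first by rewrite exprn_ge0.
apply: ler_wpM2r; first by rewrite exprn_ge0.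
rewrite -natr1; have : 0 <= (mdeg m)%:R :> R by []; nra.
Qed.

Lemma sqr_nat_le_exp4 (k : nat) : k%:R ^+ 2 <= 4 ^+ k :> R.
Proof.
have -> : 4 = 2 ^+ 2 :> R by rewrite -natrX.
rewrite exprAC lerXn2r// ?nnegrE ?exprn_ge0// -natrX ler_nat.
exact/ltnW/ltn_expl.
Qed.

(** The origin of the radius [d / 4] in all derivative estimates: since k^2 <= 4^k, shrinking to a
    quarter pays for the polynomial factors produced by first and second order differences. *)
Lemma quarter_weight (d : R) (k : nat) : 0 < d ->
  k%:R ^+ 2 * (d / 4) ^+ k <= d ^+ k.
Proof.
move=> d0; rewrite expr_div_n mulrCA ler_piMr ?exprn_ge0 ?(ltW d0)//.
rewrite ler_pdivrMr ?exprn_gt0// mul1r; exact: sqr_nat_le_exp4.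
Qed.

Lemma quarter_weight1 (d : R) (k : nat) : 0 < d ->
  k%:R * (d / 4) ^+ k <= d ^+ k.
Proof.
move=> d0; apply: le_trans (quarter_weight k d0).
apply: ler_wpM2r; first by rewrite exprn_ge0// divr_ge0// ltW.
by rewrite -natrX ler_nat; case: k => // k; rewrite expnS expn1 leq_pmulr.
Qed.

Lemma bsum_dcoef j c (d N : R) : 0 < d ->
  bsum (fun m => c m * iso_weight d m) N ->
  bsum (fun m => dcoef j c m * iso_weight (d / 4) m) ((d / 4)^-1 * N).
Proof.
move=> d0; have s0 : 0 < d / 4 by lra.
apply: (bsum_inj (h := fun m => madd m (munit j))).
- by move=> m m' _ _; exact: maddI.
- move=> m _; rewrite /dcoef /iso_weight mdegD mdegU addn1.
  set s := d / 4 in s0 *.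
  rewrite !normrM (ger0_norm (x := s ^+ _)) ?exprn_ge0 ?(ltW s0)//.
  rewrite (ger0_norm (x := d ^+ _)) ?exprn_ge0 ?(ltW d0)//.
  rewrite ler_pdivlMl// (ger0_norm (x := _.+1%:R))//.
  have -> : s * ((m j).+1%:R * `|c (madd m (munit j))| * s ^+ mdeg m) =
    `|c (madd m (munit j))| * ((m j).+1%:R * s ^+ (mdeg m).+1).
    by rewrite exprS; ring.
  apply: ler_wpM2l => //.
  apply: le_trans (quarter_weight1 (mdeg m).+1 d0).
  apply: ler_wpM2r; first by rewrite exprn_ge0// ltW.
  by rewrite ler_nat ltnS leq_mdeg.
by rewrite invr_ge0 ltW.
Qed.

(** The two sums correspond under the shift of [m] to [madd m (munit j)]; the multi-indices it
    misses have [m j = 0], and there [dmon] vanishes. *)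
Lemma has_sum_dcoef j c (d N : R) y l : 0 < d ->
  bsum (fun m => c m * iso_weight d m) N -> (forall i, `|y 0 i| <= d / 4) ->
  has_sum (fun m => dcoef j c m * mon y m) l ->
  has_sum (fun m => c m * dmon j y m) l.
Proof.
move=> d0 b ys hl; have s0 : 0 < d / 4 by lra.
have [l' hl'] : exists l, has_sum (fun m => c m * dmon j y m) l.
  apply: (@bsum_has_sum _ _ _ ((d / 4)^-1 * N)).
  have := bsumZ (d / 4)^-1 b; rewrite gtr0_norm ?invr_gt0//.
  apply: bsum_le => // m; rewrite [X in _ <= `|X|]mulrCA normrM [leRHS]normrM.
  apply: ler_wpM2l => //; rewrite [leRHS]normrM.
  rewrite (ger0_norm (x := _^-1)) ?invr_ge0 ?(ltW s0)// ler_pdivlMl//.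
  apply: (le_trans (normr_dmon_le j m ys)).
  rewrite ger0_norm ?exprn_ge0 ?(ltW d0)//; exact: quarter_weight1.
suff -> : l = l' by [].
apply: (has_sum_unique hl).
have := @has_sum_inj _ _ _ (fun m => madd m (munit j))
  (fun m => msub m (munit j)) _ _ (fun m => maddK m j) _ hl'.
move=> H; apply: (eq_has_sum _ (H _)) => m.
  by rewrite /= /dmon maddK /dcoef !ffunE eqxx addn1 mulrCA mulrA.
rewrite /dmon; have [->|mj _] := eqVneq (m j) 0%N; last exact: msubK.
by rewrite mul0r mulr0 eqxx.
Qed.

(** The monomial estimate summed over all multi-indices. Both points range over the quarter ball and
    the constant involves only [d] and [N]; this uniformity in [y] is what later replaces the
    inverse function theorem. *)
Lemma psum_taylor c (d N : R) x y fx fy (g : 'I_n -> R) (h : R) : 0 < d ->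
  bsum (fun m => c m * iso_weight d m) N ->
  (forall i, `|x 0 i| <= d / 4) -> (forall i, `|y 0 i| <= d / 4) ->
  (forall i, `|x 0 i - y 0 i| <= h) -> 0 <= h ->
  has_sum (fun m => c m * mon x m) fx -> has_sum (fun m => c m * mon y m) fy ->
  (forall j, has_sum (fun m => dcoef j c m * mon y m) (g j)) ->
  `|fx - fy - \sum_j g j * (x 0 j - y 0 j)| <= (d / 4) ^- 2 * N * h ^+ 2.
Proof.
move=> d0 b xs ys xyh h0 hx hy hg; have s0 : 0 < d / 4 by lra.
have := has_sumB (has_sumB hx hy) (@has_sum_sum _ _ _ (index_enum _) xpredT _ _
  (fun j _ => has_sumZ (x 0 j - y 0 j) (has_sum_dcoef d0 b ys (hg j)))).
have -> : \sum_j (x 0 j - y 0 j) * g j = \sum_j g j * (x 0 j - y 0 j).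
  by apply: eq_bigr => j _; rewrite mulrC.
apply: has_sum_norm_le.
have := bsumZ ((d / 4) ^- 2 * h ^+ 2) b.
rewrite ger0_norm; last by rewrite mulr_ge0 ?invr_ge0 ?exprn_ge0// ltW.
rewrite mulrAC; apply: bsum_le => // m.
have -> : c m * mon x m - c m * mon y m -
    \sum_j (x 0 j - y 0 j) * (c m * dmon j y m) =
  c m * (mon x m - mon y m - \sum_j dmon j y m * (x 0 j - y 0 j)).
  rewrite !mulrBr mulr_sumr; congr (_ - _); apply: eq_bigr => j _; ring.
rewrite [X in _ <= `|X|]mulrCA normrM [leRHS]normrM ler_wpM2l//.
rewrite [leRHS]ger0_norm; last first.
  by rewrite !mulr_ge0 ?invr_ge0 ?exprn_ge0 ?(ltW d0) ?(ltW s0).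
rewrite -mulrA ler_pdivlMl ?exprn_gt0//.
apply: (le_trans (mon_taylor m xs ys xyh (ltW s0) h0)).
rewrite mulrC; apply: ler_wpM2l; first by rewrite exprn_ge0.
exact: quarter_weight.
Qed.

End Derivative.

(** * Uniform Taylor estimates and local injectivity of analytic immersions *)

Section Taylor.
Variable R : realType.

Lemma psum_lipschitz (n : nat) (c : {ffun 'I_n -> nat} -> R) (d N : R)
    (x y : 'rV[R]_n) fx fy (h : R) : 0 < d ->
  bsum (fun m => c m * iso_weight d m) N ->
  (forall i, `|x 0 i| <= d / 4) -> (forall i, `|y 0 i| <= d / 4) ->
  (forall i, `|x 0 i - y 0 i| <= h) -> 0 <= h ->
  has_sum (fun m => c m * mon x m) fx -> has_sum (fun m => c m * mon y m) fy ->
  `|fx - fy| <= (d / 4)^-1 * N * h.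
Proof.
move=> d0 b xs ys xyh h0 hx hy; have s0 : 0 < d / 4 by lra.
apply: has_sum_norm_le (has_sumB hx hy).
have := bsumZ ((d / 4)^-1 * h) b.
rewrite ger0_norm; last by rewrite mulr_ge0 ?invr_ge0// ltW.
rewrite mulrAC; apply: bsum_le => // m.
rewrite -mulrBr [X in _ <= `|X|]mulrCA normrM [leRHS]normrM ler_wpM2l//.
rewrite [leRHS]ger0_norm; last first.
  by rewrite !mulr_ge0 ?invr_ge0 ?exprn_ge0 ?(ltW d0) ?(ltW s0).
rewrite -mulrA ler_pdivlMl//.
apply: (le_trans (mon_lipschitz m xs ys xyh (ltW s0) h0)).
rewrite mulrC; apply: ler_wpM2l => //.
exact: quarter_weight1.
Qed.

Definition mxnorm1 (n p : nat) (A : 'M[R]_(n, p)) : R :=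
  \sum_i \sum_j `|A i j|.

Lemma mxnorm1_ge0 n p (A : 'M[R]_(n, p)) : 0 <= mxnorm1 A.
Proof. by apply: sumr_ge0 => i _; apply: sumr_ge0. Qed.

Lemma normr_mulmx_le n p (v : 'rV[R]_n) (A : 'M[R]_(n, p)) :
  `|v *m A| <= mxnorm1 A * `|v|.
Proof.
apply/rV_norm_le; first by rewrite mulr_ge0 ?mxnorm1_ge0.
move=> j; rewrite mxE /mxnorm1 mulr_suml.
apply: (le_trans (ler_norm_sum _ _ _)); apply: ler_sum => i _.
rewrite normrM mulrC; apply: ler_pM => //; last exact: rV_coord_le.
by rewrite (bigD1 j)//= lerDl sumr_ge0.
Qed.

Lemma continuous_mulmxr n p (A : 'M[R]_(n, p)) :
  continuous (mulmxr A : 'rV[R]_n -> 'rV[R]_p).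
Proof.
apply/bounded_linear_continuous/linear_boundedP; near=> r => v.
by apply: (le_trans (normr_mulmx_le _ _)); apply: ler_wpM2r.
Unshelve. all: by end_near. Qed.

Lemma diff_quadratic n p (F : 'rV[R]_n -> 'rV[R]_p) (y : 'rV[R]_n)
    (A : 'M[R]_(n, p)) (C r : R) : 0 < r ->
  (forall x, `|x - y| <= r -> `|F x - F y - (x - y) *m A| <= C * `|x - y| ^+ 2) ->
  differentiable F y /\ 'd F y = mulmxr A :> ('rV[R]_n -> 'rV[R]_p).
Proof.
move=> r0 h; apply: diff_intro; first exact: continuous_mulmxr.
(* [C] has no prescribed sign; [D] is a positive constant above it. *)
move=> e e0; pose D := Num.max C 0 + 1.
have D0 : 0 < D by rewrite ltr_pwDr// le_max lexx orbT.
have CD : C <= D by rewrite /D ler_wpDr// le_max lexx.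
exists (Num.min r (e / D)); first by rewrite lt_min r0 divr_gt0.
move=> v; rewrite lt_min ltr_pdivlMr// => /andP[vr vD].
have := h (y + v); rewrite [y + v - y]addrAC subrr add0r => /(_ (ltW vr)) /le_trans.
apply; rewrite expr2 mulrA; apply: ler_wpM2r => //.
by rewrite (le_trans _ (ltW vD))// mulrC ler_wpM2l.
Qed.

(** The radius is quartered twice: the Taylor estimate holds in a quarter of the original radius,
    and the Lipschitz bound for [G] applies the same principle to the differentiated series, whose
    norm is known only on that quarter. *)
Lemma analytic_taylor n p (F : 'rV[R]_n -> 'rV[R]_p) (a : 'rV[R]_n) :
  analytic_at F a ->
  exists (d C : R) (G : 'rV[R]_n -> 'M[R]_(n, p)), [/\ 0 < d, 0 <= C,
    (forall x y, `|x - a| <= d -> `|y - a| <= d ->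
      `|F x - F y - (x - y) *m G y| <= C * `|x - y| ^+ 2) &
    (forall y i j, `|y - a| <= d -> `|G y i j - G a i j| <= C * `|y - a|)].
Proof.
move=> Fa.
have [d d0 hd] : exists2 d, 0 < d & forall j, exists N,
    wexp (iso_weight d) N (fun x => F (a + x) 0 j).
  apply: (@common_radius _ _ (fun j d => exists N,
    wexp (iso_weight d) N (fun x => F (a + x) 0 j))).
    move=> j s s' s0 ss [N h]; exists N; apply: wexp_iso_le h => //; exact: ltW.
  by move=> j; have /analytic_wexp[s [N [s0 h]]] := Fa j; exists s => //; exists N.
have /choice[cN hc] : forall j, exists cN : ({ffun 'I_n -> nat} -> R) * R,
    bsum (fun m => cN.1 m * iso_weight d m) cN.2 /\
    forall x, `|x| <= d -> has_sum (fun m => cN.1 m * mon x m) (F (a + x) 0 j).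
  move=> j; have [N [c h1 h2]] := hd j; exists (c, N); split=> // x xd.
  by apply: h2; apply/wdom_isoE => //; exact: ltW.
pose N := \sum_j (cN j).2.
have N_ge0 j : 0 <= (cN j).2 by exact: bsum_ge0 (hc j).1.
have N0 : 0 <= N by apply: sumr_ge0.
have bN j : bsum (fun m => (cN j).1 m * iso_weight d m) N.
  apply: bsum_le (hc j).1 => //.
  by rewrite /N (bigD1 j)//= lerDl sumr_ge0.
pose s := d / 4; have s0 : 0 < s by rewrite /s; lra.
have sd : s <= d by rewrite /s; lra.
have s4 : s / 4 <= s by lra.
have s40 : 0 < s / 4 by lra.
have s41 : s / 4 <= d by lra.
have dN i j := bsum_dcoef i d0 (bN j).
have /choice[g hg] : forall t : 'rV[R]_n * 'I_n * 'I_p, exists l,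
    `|t.1.1| <= s -> has_sum (fun m => dcoef t.1.2 (cN t.2).1 m * mon t.1.1 m) l.
  move=> [[y i] j] /=; have [ys|_] := boolP (`|y| <= s); last by exists 0.
  have wy : wdom (iso_weight (d / 4)) y by apply/wdom_isoE => //; exact: ltW.
  by have [l hl] := bsum_has_sum (wdom_bsum wy (dN i j)); exists l.
pose C := s ^- 2 * N + (s / 4)^-1 * (s^-1 * N).
have C10 : 0 <= s ^- 2 * N by rewrite mulr_ge0 ?invr_ge0 ?exprn_ge0 ?(ltW s0).
have C20 : 0 <= (s / 4)^-1 * (s^-1 * N).
  by rewrite !mulr_ge0 ?invr_ge0 ?(ltW s0) ?(ltW s40).
have shift (x : 'rV[R]_n) : a + (x - a) = x by rewrite addrCA subrr addr0.
exists (s / 4), C, (fun y => \matrix_(i, j) g (y - a, i, j)); split=> //.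
- exact: addr_ge0.
- move=> x y xa ya; apply/rV_norm_le; first by rewrite mulr_ge0 ?exprn_ge0 ?addr_ge0.
  move=> j; apply: (@le_trans _ _ (s ^- 2 * N * `|x - y| ^+ 2)); last first.
    by apply: ler_wpM2r; rewrite ?exprn_ge0// lerDl.
  have xs := le_trans xa s4; have ys := le_trans ya s4.
  have := @psum_taylor _ _ _ d N (x - a) (y - a) (F x 0 j) (F y 0 j)
    (fun i => g (y - a, i, j)) `|x - y| d0 (bN j).
  have -> : \sum_i g (y - a, i, j) * ((x - a) 0 i - (y - a) 0 i) =
      ((x - y) *m \matrix_(i, j) g (y - a, i, j)) 0 j.
    rewrite mxE; apply: eq_bigr => i _; rewrite !mxE mulrC; congr (_ * _); ring.
  rewrite !mxE; apply=> //.
  + by move=> i; apply: le_trans (rV_coord_le _ _) _.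
  + by move=> i; apply: le_trans (rV_coord_le _ _) _.
  + move=> i; apply: le_trans (rV_coord_le (x - y) i); rewrite !mxE.
    by rewrite opprB addrA subrK.
  + by have := (hc j).2 (x - a); rewrite shift; apply; apply: le_trans xs _.
  + by have := (hc j).2 (y - a); rewrite shift; apply; apply: le_trans ys _.
  + by move=> i; apply: (hg (y - a, i, j)).
move=> y i j ya; rewrite !mxE subrr.
apply: (@le_trans _ _ ((s / 4)^-1 * (s^-1 * N) * `|y - a|)); last first.
  by apply: ler_wpM2r; rewrite // lerDr.
have ys := le_trans ya s4.
apply: (@psum_lipschitz _ _ s _ (y - a) 0 _ _ _ s0 (dN i j)) => //.
- by move=> k; apply: le_trans (rV_coord_le _ _) _.
- by move=> k; rewrite mxE normr0 ltW.
- move=> k; have -> : (0 : 'rV[R]_n) 0 k = 0 by rewrite mxE.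
  by rewrite subr0; exact: rV_coord_le.
- by apply: (hg (y - a, i, j)).
- by apply: (hg (0, i, j)); rewrite /= normr0 ltW.
Qed.

Lemma analytic_differentiable n p (F : 'rV[R]_n -> 'rV[R]_p) (a : 'rV[R]_n) :
  analytic_at F a -> differentiable F a.
Proof.
move=> /analytic_taylor[d [C [G [d0 C0 hT _]]]].
have [] // := @diff_quadratic _ _ F a (G a) C d d0 _.
by move=> x xa; apply: hT => //; rewrite subrr normr0 ltW.
Qed.

Lemma mulmx_inj_bound n p (A : 'M[R]_(n, p)) :
  injective (mulmxr A : 'rV[R]_n -> 'rV[R]_p) ->
  exists2 k : R, 0 < k & forall v : 'rV[R]_n, `|v| <= k * `|v *m A|.
Proof.
move=> iA; have /row_freeP[B AB] : row_free A.
  by apply: inj_row_free => v vA; apply: iA; rewrite /= vA mul0mx.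
exists (mxnorm1 B + 1); first by have := mxnorm1_ge0 B; lra.
move=> v; rewrite -{1}[v]mulmx1 -AB mulmxA.
apply: (le_trans (normr_mulmx_le _ _)); apply: ler_wpM2r => //; lra.
Qed.

(** F x - F y differs from the injective linear map [G a] applied to x - y by the Taylor remainder
    at [y] and by the variation of [G] from [a] to [y]. Both errors are small multiples of |x - y|
    near [a] and are absorbed into the left-hand side. *)
Lemma analytic_immersion n p (F : 'rV[R]_n -> 'rV[R]_p) (a : 'rV[R]_n) :
  analytic_at F a -> injective ('d F a) ->
  exists r k : R, [/\ 0 < r, 0 < k & forall x y, `|x - a| < r -> `|y - a| < r ->
    `|x - y| <= k * `|F x - F y|].
Proof.
move=> /analytic_taylor[d [C [G [d0 C0 hT hG]]]] inj.
have dE : 'd F a = mulmxr (G a) :> ('rV[R]_n -> 'rV[R]_p).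
  have [] // := @diff_quadratic _ _ F a (G a) C d d0 _.
  by move=> x xa; apply: hT => //; rewrite subrr normr0 ltW.
have [k k0 hk] : exists2 k : R, 0 < k & forall v : 'rV[R]_n, `|v| <= k * `|v *m G a|.
  by apply: mulmx_inj_bound => u v uv; apply: inj; rewrite dE.
pose S : R := n%:R * p%:R.
have S0 : 0 <= S by rewrite mulr_ge0.
(* With both points within [z = 2^-1 / D] of [a], their distance is at most [2 * z] and the errors
   amount to at most half of |x - y|; this half is the source of the constant [2 * k]. [S] counts
   the matrix entries. *)
pose D := k * (C * 2 + C * S) + 1.
have D0 : 0 < D by rewrite ltr_wpDl// !(mulr_ge0, addr_ge0)// ltW.
exists (Num.min d (2^-1 / D)), (2 * k); split; first by rewrite lt_min d0 !divr_gt0.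
  by rewrite mulr_gt0.
move=> x y; rewrite !lt_min => /andP[xd xD] /andP[yd yD].
have h1 := hT x y (ltW xd) (ltW yd).
have h2 : `|(x - y) *m (G y - G a)| <= C * S * `|y - a| * `|x - y|.
  apply: (le_trans (normr_mulmx_le _ _)); apply: ler_wpM2r => //.
  rewrite /mxnorm1 (le_trans (ler_sum _ (fun i _ => ler_sum _
    (fun j _ => _ : _ <= C * `|y - a|))))//.
    by move=> i _ j _; rewrite !mxE; apply: hG; exact: ltW.
  by rewrite !sumr_const !card_ord -!mulrnA -mulr_natr natrM /S; nra.
have h3 := hk (x - y).
have e3 : (x - y) *m G a =
    (F x - F y) - (F x - F y - (x - y) *m G y) - (x - y) *m (G y - G a).
  by rewrite mulmxBr !subKr.
have h4 : `|(x - y) *m G a| <= `|F x - F y| + C * `|x - y| ^+ 2 +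
    C * S * `|y - a| * `|x - y|.
  rewrite e3; apply: (le_trans (ler_normB _ _)); rewrite lerD//.
  by apply: (le_trans (ler_normB _ _)); rewrite lerD.
have xy : `|x - y| <= 2 * (2^-1 / D).
  rewrite -(subrK a x) -addrA; apply: (le_trans (ler_normD _ _)).
  rewrite (distrC a y); lra.
set u := `|x - y| in h1 h2 h3 h4 xy *; set v := `|y - a| in yD h2 h4.
set f := `|F x - F y| in h4 *; set z := 2^-1 / D in yD xD xy.
have u0 : 0 <= u by rewrite /u.
have zD : D * z = 2^-1 by rewrite /z mulrCA divff ?mulr1// gt_eqF.
have b1 : k * (C * u ^+ 2 + C * S * v * u) <= 2^-1 * u.
  have -> : k * (C * u ^+ 2 + C * S * v * u) = (k * (C * u + C * S * v)) * u.
    by ring.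
  apply: ler_wpM2r => //; rewrite -zD.
  have z0 : 0 < z by rewrite divr_gt0.
  apply: (@le_trans _ _ (k * (C * (2 * z) + C * S * z))); last first.
    by rewrite /D; nra.
  apply: ler_wpM2l; first exact: ltW.
  by rewrite lerD// ler_wpM2l ?mulr_ge0// ltW.
have : k * `|(x - y) *m G a| <= k * (f + C * u ^+ 2 + C * S * v * u).
  by apply: ler_wpM2l => //; exact: ltW.
rewrite -addrA mulrDr => h5; lra.
Qed.

End Taylor.

(** * The linear Cauchy-Kovalevskaya theorem *)

Section CauchyKovalevskaya.
Variables (R : realType) (n : nat) (t : 'I_n).
Implicit Types (c : {ffun 'I_n -> nat} -> R) (m : {ffun 'I_n -> nat}).

(** The left-hand side is one term of Vandermonde's sum. *)
Lemma leq_binM (a b i j : nat) : ('C(a, i) * 'C(b, j) <= 'C(a + b, i + j))%N.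
Proof.
rewrite -binomial.Vandermonde (bigD1 (inord i : 'I_(i + j).+1))//=.
rewrite inordK ?ltnS ?leq_addr//.
by rewrite addKn leq_addr.
Qed.

Lemma bin_le_exp2 (a i : nat) : ('C(a, i) <= 2 ^ a)%N.
Proof.
elim: a i => [|a IH] [|i]; rewrite ?bin0 ?expn_gt0//.
by rewrite binS expnS mul2n -addnn leq_add.
Qed.

(* Dividing by the binomial coefficient makes the weight compensate exactly the
   factor m_j / (m_t + 1) produced by d_j \int dx_t, while Vandermonde's identity
   keeps the weight submultiplicative. *)
Definition ck_weight (rho lam : R) m : R :=
  rho ^+ mdeg m * lam ^+ m t / 'C(mdeg m, m t)%:R.

(** The primitive in direction [t] that vanishes on x_t = 0: no term with [m t = 0] occurs. *)
Definition prim_coef c m : R :=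
  if m t == 0%N then 0 else (m t)%:R^-1 * c (msub m (munit t)).

Lemma ck_weightP (rho lam : R) : 0 < rho -> 0 < lam -> weight (ck_weight rho lam).
Proof.
move=> r0 l0.
have b0 m : 0 < 'C(mdeg m, m t)%:R :> R by rewrite ltr0n bin_gt0 leq_mdeg.
split=> [|m|m m']; rewrite /ck_weight.
- by rewrite mdeg0 !ffunE bin0 !expr0 invr1 !mulr1.
- by rewrite divr_gt0// mulr_gt0// exprn_gt0.
have -> : rho ^+ mdeg m * lam ^+ m t / 'C(mdeg m, m t)%:R *
    (rho ^+ mdeg m' * lam ^+ m' t / 'C(mdeg m', m' t)%:R) =
  rho ^+ mdeg (madd m m') * lam ^+ (madd m m') t /
    ('C(mdeg m, m t) * 'C(mdeg m', m' t))%:R.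
  by rewrite mdegD ffunE !exprD natrM invfM; ring.
apply: ler_wpM2l; first by rewrite mulr_ge0// exprn_ge0// ltW.
rewrite lef_pV2 ?posrE//; last by rewrite natrM mulr_gt0.
by rewrite ler_nat mdegD ffunE leq_binM.
Qed.

Lemma ck_weight_le (rho lam : R) m : 0 < rho -> 0 < lam <= 1 ->
  ck_weight rho lam m <= iso_weight rho m.
Proof.
move=> r0 /andP[l0 l1]; rewrite /ck_weight /iso_weight -mulrA ler_piMr//.
  by rewrite exprn_ge0// ltW.
rewrite ler_pdivrMr ?ltr0n ?bin_gt0 ?leq_mdeg// mul1r.
apply: (@le_trans _ _ 1); first by rewrite exprn_ile1// ltW.
by rewrite ler1n bin_gt0 leq_mdeg.
Qed.

(** Since [lam <= 1], the power of [lam] with exponent [m t] dominates the one with exponent |m|,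
    and the binomial coefficient is at most 2^|m|. This is the return from the anisotropic weight to
    an honest polydisc. *)
Lemma ck_weight_ge (rho lam : R) m : 0 < rho -> 0 < lam <= 1 ->
  iso_weight (rho * lam / 2) m <= ck_weight rho lam m.
Proof.
move=> r0 /andP[l0 l1]; rewrite /ck_weight /iso_weight expr_div_n exprMn.
apply: ler_pM.
- by rewrite mulr_ge0// exprn_ge0// ltW.
- by rewrite invr_ge0 exprn_ge0.
- apply: ler_wpM2l; first by rewrite exprn_ge0// ltW.
  by apply: ler_wiXn2l; rewrite ?l1 ?(ltW l0)// leq_mdeg.
rewrite lef_pV2 ?posrE ?exprn_gt0 ?ltr0n ?bin_gt0 ?leq_mdeg//.
by rewrite -natrX ler_nat bin_le_exp2.
Qed.

Lemma dcoef_prim c m : dcoef t (prim_coef c) m = c m.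
Proof.
rewrite /dcoef /prim_coef maddK !ffunE eqxx addn1 /=.
by rewrite mulrA divff ?mul1r// pnatr_eq0.
Qed.

Lemma dcoef_prim_neq j c m : j != t -> dcoef j (prim_coef c) m =
  if m t == 0%N then 0
  else (m j).+1%:R / (m t)%:R * c (madd (msub m (munit t)) (munit j)).
Proof.
move=> jt; rewrite /dcoef /prim_coef !ffunE [t == j]eq_sym (negbTE jt) addn0.
case: eqVneq => mt; first by rewrite mulr0.
rewrite mulrA; congr (_ * c _); apply/ffunP => i; rewrite !ffunE.
case: (eqVneq i t) => [->|_]; last by rewrite !subn0.
by rewrite [t == j]eq_sym (negbTE jt) !addn0.
Qed.

(** Let [m1] be the multi-index of the coefficient that is moved to [m], D its degree and k its
    exponent at [t]. The coefficient is multiplied by m1_j / (k + 1) and the weight by lam (k + 1) /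
    (D - k). The product lam m1_j / (D - k) is at most lam because the exponents away from [t] add
    up to D - k. *)
Lemma bsum_dcoef_prim (rho lam N : R) j c : 0 < rho -> 0 < lam -> j != t ->
  bsum (fun m => c m * ck_weight rho lam m) N ->
  bsum (fun m => dcoef j (prim_coef c) m * ck_weight rho lam m) (lam * N).
Proof.
move=> r0 l0 jt; have [_ wp _] := ck_weightP r0 l0.
have supp m : dcoef j (prim_coef c) m * ck_weight rho lam m != 0 -> m t != 0%N.
  by apply: contraNN => /eqP mt; rewrite dcoef_prim_neq// mt eqxx mul0r.
apply: (bsum_inj (h := fun m => madd (msub m (munit t)) (munit j))) (ltW l0).
- move=> m m' /supp mt /supp mt' /maddI e.
  by rewrite -(msubK mt) e msubK.
move=> m /supp mt; rewrite dcoef_prim_neq// (negbTE mt).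
set m1 := madd (msub m (munit t)) (munit j).
have m1t : (m t = (m1 t).+1)%N.
  by rewrite !ffunE eqxx [t == j]eq_sym (negbTE jt) addn0 subn1 prednK// lt0n.
have m1j : ((m j).+1 = m1 j)%N.
  by rewrite !ffunE eqxx (negbTE jt) subn0 addn1.
have m1d : mdeg m = mdeg m1.
  by rewrite -{1}(msubK mt) !mdegD !mdegU.
rewrite (normrM _ (ck_weight rho lam m)) (normrM _ (ck_weight rho lam m1)).
rewrite !(gtr0_norm (wp _)) normrM mulrAC [leRHS]mulrCA [leLHS]mulrC.
rewrite ler_wpM2l// ger0_norm; last by rewrite mulr_ge0 ?invr_ge0.
rewrite /ck_weight m1d m1t m1j.
set D := mdeg m1; set k := m1 t.
have kD : (k <= D)%N by exact: leq_mdeg.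
have jD : (m1 j <= D - k)%N by rewrite leq_subRL// addnC leq_mdeg2.
have [kD0|Dk] := posnP (D - k).
  by rewrite kD0 -m1j in jD.
have b1 : 0 < 'C(D, k)%:R :> R by rewrite ltr0n bin_gt0.
have b2 : 0 < 'C(D, k.+1)%:R :> R by rewrite ltr0n bin_gt0 -subn_gt0.
have key : k.+1%:R * 'C(D, k.+1)%:R = (D - k)%:R * 'C(D, k)%:R :> R.
  by rewrite -!natrM mul_bin_left.
have -> : (m1 j)%:R / k.+1%:R * (rho ^+ D * lam ^+ k.+1 / 'C(D, k.+1)%:R) =
  rho ^+ D * lam ^+ k.+1 * ((m1 j)%:R / (k.+1%:R * 'C(D, k.+1)%:R)).
  by rewrite invfM; ring.
rewrite exprS [leRHS]mulrA [lam * (_ * _)]mulrCA.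
apply: ler_wpM2l; first by rewrite !mulr_ge0 ?exprn_ge0// ltW.
rewrite key invfM mulrA ler_piMl ?invr_ge0 ?(ltW b1)//.
by rewrite ler_pdivrMr ?ltr0n// mul1r ler_nat.
Qed.

Lemma bsum_prim (d N : R) c : 0 < d ->
  bsum (fun m => c m * iso_weight d m) N ->
  bsum (fun m => prim_coef c m * iso_weight d m) (d * N).
Proof.
move=> d0.
have supp m : prim_coef c m * iso_weight d m != 0 -> m t != 0%N.
  by apply: contraNN => /eqP mt; rewrite /prim_coef mt eqxx mul0r.
apply: (bsum_inj (h := fun m => msub m (munit t))) (ltW d0).
- by move=> m m' /supp mt /supp mt' e; rewrite -(msubK mt) e msubK.
move=> m /supp mt; rewrite /prim_coef (negbTE mt).
have -> : iso_weight d m = d * iso_weight d (msub m (munit t)).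
  by rewrite -{1}(msubK mt) /iso_weight mdegD mdegU addn1 exprS.
rewrite mulrCA normrM (gtr0_norm d0) ler_wpM2l ?(ltW d0)// -mulrA normrM.
rewrite ler_piMl// ger0_norm ?invr_ge0// invf_le1 ?ltr0n ?lt0n//.
by rewrite ler1n lt0n.
Qed.

Section Solve.
Variables (K : finType) (rho lam : R) (A : K -> K -> 'I_n -> 'rV[R]_n -> R)
  (NA : K -> K -> 'I_n -> R).
Hypotheses (r0 : 0 < rho) (l0 : 0 < lam).
Let w := ck_weight rho lam.
Hypothesis hA : forall k l j, wexp w (NA k l j) (A k l j).
Hypothesis hlam : forall k, \sum_l \sum_(j | j != t) NA k l j * lam <= 2^-1.

Let ww : weight w := ck_weightP r0 l0.

(** One term of the Neumann series: [hlam] makes the operator halve the norm. The values [p] are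
    left arbitrary up to the sums they represent, so the caller may choose them for all terms at
    once. *)
Lemma ck_step (g : K -> {ffun 'I_n -> nat} -> R) (N : R) :
  (forall k, bsum (fun m => g k m * w m) N) -> 0 <= N ->
  exists g' : K -> {ffun 'I_n -> nat} -> R,
    (forall k, bsum (fun m => g' k m * w m) (N * 2^-1)) /\
    forall x (p : K -> 'I_n -> R), wdom w x ->
      (forall l j, j != t ->
        has_sum (fun m => dcoef j (prim_coef (g l)) m * mon x m) (p l j)) ->
      forall k, has_sum (fun m => g' k m * mon x m)
        (\sum_l \sum_(j | j != t) A k l j x * p l j).
Proof.
move=> gN N0.
(* Default 0 for [j = t] and outside the domain; elsewhere uniqueness of sums identifies these
   values with the given [p]. *)
have /choice[p0 hp0] : forall xlj : 'rV[R]_n * K * 'I_n, exists l, xlj.2 != t ->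
    wdom w xlj.1.1 -> has_sum
      (fun m => dcoef xlj.2 (prim_coef (g xlj.1.2)) m * mon xlj.1.1 m) l.
  move=> [[x l] j] /=; case: (eqVneq j t) => [_|jt]; first by exists 0.
  have [wx|nwx] := pselect (wdom w x); last by exists 0.
  have [s hs] := bsum_has_sum (wdom_bsum wx (bsum_dcoef_prim r0 l0 jt (gN l))).
  by exists s.
have f0 l j : j != t -> wexp w (lam * N) (fun x => p0 (x, l, j)).
  move=> jt; exists (dcoef j (prim_coef (g l))); first exact: bsum_dcoef_prim.
  by move=> x wx; exact: (hp0 (x, l, j)).
have /choice[g' hg'] : forall k, exists g' : {ffun 'I_n -> nat} -> R,
    bsum (fun m => g' m * w m) (N * 2^-1) /\ forall x, wdom w x ->
    has_sum (fun m => g' m * mon x m)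
      (\sum_l \sum_(j | j != t) A k l j x * p0 (x, l, j)).
  move=> k.
  have : wexp w (N * 2^-1)
      (fun x => \sum_l \sum_(j | j != t) A k l j x * p0 (x, l, j)).
    apply: (@wexp_le _ _ w w (\sum_l \sum_(j | j != t) NA k l j * (lam * N))).
    - by case: ww => _ wp _ m; exact: ltW.
    - by [].
    - have := ler_wpM2l N0 (hlam k); apply: le_trans.
      rewrite mulr_sumr; apply: ler_sum => l _.
      by rewrite mulr_sumr; apply: ler_sum => j _; rewrite mulrA mulrC.
    apply: wexp_sum => // l _; apply: wexp_sum => // j jt.
    by apply: wexpM => //; exact: f0.
  by case=> g' h1 h2; exists g'.
exists g'; split=> [k|x p wx hp k]; first exact: (hg' k).1.
have := (hg' k).2 x wx.
suff -> : \sum_l \sum_(j | j != t) A k l j x * p0 (x, l, j) =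
    \sum_l \sum_(j | j != t) A k l j x * p l j by [].
apply: eq_bigr => l _; apply: eq_bigr => j jt; congr (_ * _).
exact: (has_sum_unique (hp0 (x, l, j) jt wx) (hp l j jt)).
Qed.

Lemma ck_solve (B : K -> 'rV[R]_n -> R) (N : R) :
  (forall k, wexp w N (B k)) -> 0 <= N ->
  exists (g : K -> {ffun 'I_n -> nat} -> R) (p : 'rV[R]_n -> K -> 'I_n -> R),
    [/\ forall k, bsum (fun m => g k m * w m) (2 * N),
      forall x l j, wdom w x -> j != t ->
        has_sum (fun m => dcoef j (prim_coef (g l)) m * mon x m) (p x l j) &
      forall x k, wdom w x -> has_sum (fun m => g k m * mon x m)
        (B k x + \sum_l \sum_(j | j != t) A k l j x * p x l j)].
Proof.
move=> hB N0; have [_ wp _] := ww.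
(* The step becomes a total function of a family and its bound, so that the iteration [gs] is a
   plain recursion carrying no proofs. *)
have /choice[S hS] : forall gN : (K -> {ffun 'I_n -> nat} -> R) * R, exists g',
    (forall k, bsum (fun m => gN.1 k m * w m) gN.2) -> 0 <= gN.2 ->
    (forall k, bsum (fun m => g' k m * w m) (gN.2 * 2^-1)) /\
    forall x (p : K -> 'I_n -> R), wdom w x ->
      (forall l j, j != t ->
        has_sum (fun m => dcoef j (prim_coef (gN.1 l)) m * mon x m) (p l j)) ->
      forall k, has_sum (fun m => g' k m * mon x m)
        (\sum_l \sum_(j | j != t) A k l j x * p l j).
  move=> [g M] /=.
  have [[h M0]|nh] := pselect ((forall k, bsum (fun m => g k m * w m) M) /\ 0 <= M).
    by have [g' hg'] := ck_step h M0; exists g'.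
  by exists g => h M0; case: nh.
have /choice[g0 hg0] : forall k, exists g0 : {ffun 'I_n -> nat} -> R,
    bsum (fun m => g0 m * w m) N /\
    forall x, wdom w x -> has_sum (fun m => g0 m * mon x m) (B k x).
  by move=> k; have [g0 h1 h2] := hB k; exists g0.
pose gs := fix gs s := if s is s'.+1 then S (gs s', N * 2^-1 ^+ s') else g0.
have Ns0 s : 0 <= N * 2^-1 ^+ s by rewrite mulr_ge0// exprn_ge0// invr_ge0.
have gsN s k : bsum (fun m => gs s k m * w m) (N * 2^-1 ^+ s).
  elim: s k => [|s IH] k /=; first by rewrite mulr1; exact: (hg0 k).1.
  rewrite exprSr mulrA.
  by have [+ _] := hS (gs s, N * 2^-1 ^+ s) IH (Ns0 s); apply.
have bN := bsum_geometric N0.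
have /choice[g hg] : forall k, exists g, forall m, has_sum (fun s => gs s k m) (g m).
  by move=> k; exact: coef_series_ex wp (fun s => gsN s k) bN.
have dg j l m : j != t -> has_sum (fun s => dcoef j (prim_coef (gs s l)) m)
    (dcoef j (prim_coef (g l)) m).
  move=> jt; rewrite dcoef_prim_neq//.
  have [mt|mt] := eqVneq (m t) 0%N.
    apply: (eq_has_sum _ (@has_sum0 _ _)) => s.
    by rewrite dcoef_prim_neq// mt eqxx.
  apply: (eq_has_sum _ (has_sumZ _ (hg l _))) => s.
  by rewrite dcoef_prim_neq// (negbTE mt).
have bP s j l (jt : j != t) := bsum_dcoef_prim r0 l0 jt (gsN s l).
have bN' : bsum (fun s => lam * (N * 2^-1 ^+ s)) (lam * (2 * N)).
  by have := bsumZ lam bN; rewrite (gtr0_norm l0).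
have ex x l j s : exists v, wdom w x -> j != t ->
    has_sum (fun m => dcoef j (prim_coef (gs s l)) m * mon x m) v.
  have [wx|nwx] := pselect (wdom w x); last by exists 0.
  have [_|jt] := eqVneq j t; first by exists 0.
  by have [v hv] := bsum_has_sum (wdom_bsum wx (bP s j l jt)); exists v.
have /choice[ps hps] : forall xljs : 'rV[R]_n * K * 'I_n * nat, exists v,
    wdom w xljs.1.1.1 -> xljs.1.2 != t ->
    has_sum (fun m => dcoef xljs.1.2 (prim_coef (gs xljs.2 xljs.1.1.2)) m *
      mon xljs.1.1.1 m) v.
  by move=> [[[x l] j] s]; exact: ex.
have /choice[p hp] : forall xlj : 'rV[R]_n * K * 'I_n, exists v,
    wdom w xlj.1.1 -> xlj.2 != t -> has_sum (fun s => ps (xlj, s)) v /\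
    has_sum (fun m => dcoef xlj.2 (prim_coef (g xlj.1.2)) m * mon xlj.1.1 m) v.
  move=> [[x l] j] /=.
  have [wx|nwx] := pselect (wdom w x); last by exists 0.
  have [_|jt] := eqVneq j t; first by exists 0.
  have [_ h] := coef_series wp (fun s => bP s j l jt) bN' (fun m => dg j l m jt).
  have [v h1 h2] := h x (fun s => ps (x, l, j, s)) wx
    (fun s => hps (x, l, j, s) wx jt).
  by exists v.
exists g, (fun x l j => p (x, l, j)); split.
- move=> k; exact: (coef_series wp (fun s => gsN s k) bN (hg k)).1.
- by move=> x l j wx jt; exact: (hp (x, l, j) wx jt).2.
move=> x k wx.
pose E s := if s is s'.+1 then \sum_l \sum_(j | j != t) A k l j x * ps (x, l, j, s')
  else B k x.
have hE s : has_sum (fun m => gs s k m * mon x m) (E s).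
  case: s => [|s] /=; first exact: (hg0 k).2.
  have [_] := hS (gs s, N * 2^-1 ^+ s) (gsN s) (Ns0 s).
  move=> /(_ x (fun l j => ps (x, l, j, s)) wx); apply=> l j jt.
  exact: (hps (x, l, j, s)).
have [_ h] := coef_series wp (fun s => gsN s k) bN (hg k).
have [v hv hgv] := h x E wx hE.
(* Without its initial term, the Neumann series is the operator applied to the whole series.
   Comparing the two sums gives the fixed point equation. *)
have hv1 := has_sumS hv.
have hv2 : has_sum (fun s => E s.+1)
    (\sum_l \sum_(j | j != t) A k l j x * p (x, l, j)).
  apply: has_sum_sum => l _; apply: has_sum_sum => j jt; apply: has_sumZ.
  exact: (hp (x, l, j) wx jt).1.
by rewrite -(has_sum_unique hv1 hv2) addrC subrK.
Qed.

End Solve.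

(* The system is d_t U_k = \sum A_klj d_j U_l; G k y j stands for the j-th partial
   derivative of U k at y. *)
Lemma cauchy_kovalevskaya (K : finType) (A : K -> K -> 'I_n -> 'rV[R]_n -> R)
    (b : K -> 'I_n -> R) :
  (forall k l j, analytic_fun_at (A k l j) 0) ->
  exists (d C : R) (U : K -> 'rV[R]_n -> R) (G : K -> 'rV[R]_n -> 'I_n -> R),
    [/\ 0 < d, forall k, analytic_fun_at (U k) 0,
      forall k x y, `|x| <= d -> `|y| <= d ->
        `|U k x - U k y - \sum_j G k y j * (x 0 j - y 0 j)| <= C * `|x - y| ^+ 2,
      forall k y, `|y| <= d ->
        G k y t = \sum_l \sum_(j | j != t) A k l j y * G l y j &
      forall k j, j != t -> G k 0 j = b k j].
Proof.
move=> anA.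
have [rho r0 hrho] : exists2 rho, 0 < rho & forall klj : K * K * 'I_n, exists N,
    wexp (iso_weight rho) N (A klj.1.1 klj.1.2 klj.2).
  apply: (@common_radius _ _ (fun klj rho => exists N,
    wexp (iso_weight rho) N (A klj.1.1 klj.1.2 klj.2))).
    by move=> j s s' s0 ss [N h]; exists N; apply: wexp_iso_le h => //; exact: ltW.
  move=> [[k l] j] /=; have /analytic_wexp[s [N [s0 h]]] := anA k l j.
  by exists s => //; exists N; apply: eq_wexp h => x _; rewrite add0r.
have {hrho}/choice[NA hNA] := hrho.
have NA0 klj : 0 <= NA klj by exact: wexp_ge0 (hNA klj).
(* The sum over all indices dominates every row of the system, so [lam = (2 * T)^-1] makes the
   operator norm at most 1/2; the summand 1 ensures [lam <= 1]. *)
pose T := 1 + \sum_klj NA klj.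
have T0 : 0 < T by rewrite ltr_pwDl// sumr_ge0.
have T1 : 1 <= T by rewrite lerDl sumr_ge0.
pose lam := (2 * T)^-1.
have l0 : 0 < lam by rewrite invr_gt0 mulr_gt0.
have l1 : lam <= 1 by rewrite invf_le1 ?mulr_gt0//; lra.
have l01 : 0 < lam <= 1 by rewrite l0.
pose w := ck_weight rho lam.
have ww : weight w := ck_weightP r0 l0.
have [_ wp _] := ww.
have hA k l j : wexp w (NA (k, l, j)) (A k l j).
  apply: wexp_le (hNA (k, l, j)) => // m; first exact: ltW.
  exact: ck_weight_le.
have hlam k : \sum_l \sum_(j | j != t) NA (k, l, j) * lam <= 2^-1.
  have : \sum_l \sum_(j | j != t) NA (k, l, j) * lam <= T * lam.
    under eq_bigr do rewrite -mulr_suml.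
    rewrite -mulr_suml; apply: ler_wpM2r; first exact: ltW.
    rewrite /T; apply: ler_wpDl => //.
    rewrite (eq_bigr (fun klj => NA (klj.1, klj.2)));
      last by move=> [[? ?] ?] _.
    rewrite -(pair_bigA _ (fun kl j => NA (kl, j))) /=.
    rewrite (eq_bigr (fun kl => \sum_j NA (kl.1, kl.2, j))); last by move=> [? ?] _.
    rewrite -(pair_bigA _ (fun k l => \sum_j NA (k, l, j))) /=.
    rewrite [leRHS](bigD1 k)//= ler_wpDr//.
      by apply: sumr_ge0 => ? _; apply: sumr_ge0 => ? _; apply: sumr_ge0.
    apply: ler_sum => l _; rewrite [leRHS](bigID (fun j => j != t)) /= lerDl.
    exact: sumr_ge0.
  move=> /le_trans; apply; rewrite /lam invfM mulrCA divff ?mulr1//.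
  by rewrite gt_eqF.
(* The unknown is split as a linear function with the prescribed gradient along x_t = 0 plus a part
   vanishing there; [B] is what the linear function contributes to the equation. *)
pose B k x := \sum_l \sum_(j | j != t) A k l j x * b l j.
have [N [N0 hB]] : exists N, 0 <= N /\ forall k, wexp w N (B k).
  have hBk k : wexp w (\sum_l \sum_(j | j != t) NA (k, l, j) * `|b l j|) (B k).
    apply: wexp_sum => // l _; apply: wexp_sum => // j _.
    by apply: wexpM => //; exact: wexp_cst.
  have N0 k : 0 <= \sum_l \sum_(j | j != t) NA (k, l, j) * `|b l j|.
    by apply: sumr_ge0 => l _; apply: sumr_ge0 => j _; apply: mulr_ge0.
  exists (\sum_k \sum_l \sum_(j | j != t) NA (k, l, j) * `|b l j|).
  split=> [|k]; first exact: sumr_ge0.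
  apply: wexp_le (hBk k) => // [m|]; first exact: ltW.
  by rewrite [leRHS](bigD1 k)//= lerDl sumr_ge0.
have [g [p [gN hp hg]]] := ck_solve r0 l0 hA hlam hB N0.
pose d := rho * lam / 2.
have d0 : 0 < d by rewrite divr_gt0// mulr_gt0.
have gd k : bsum (fun m => g k m * iso_weight d m) (2 * N).
  apply: bsum_le (gN k) => // m; rewrite normrM [leRHS]normrM ler_wpM2l//.
  rewrite (gtr0_norm (wp m)) ger0_norm; first exact: ck_weight_ge.
  by rewrite exprn_ge0// ltW.
have cd k := bsum_prim d0 (gd k).
have wd (x : 'rV[R]_n) : `|x| <= d -> wdom w x.
  move=> /(wdom_isoE x (ltW d0)) h m; exact: le_trans (h m) (ck_weight_ge _ _ _).
have /choice[V hV] : forall kx : K * 'rV[R]_n, exists v, `|kx.2| <= d ->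
    has_sum (fun m => prim_coef (g kx.1) m * mon kx.2 m) v.
  move=> [k x] /=; have [xd|_] := boolP (`|x| <= d); last by exists 0.
  have wx := (wdom_isoE x (ltW d0)).2 xd.
  by have [v hv] := bsum_has_sum (wdom_bsum wx (cd k)); exists v.
pose G k y j := if j == t then
    B k y + \sum_l \sum_(j | j != t) A k l j y * p y l j else p y k j.
have hG k y j : `|y| <= d ->
    has_sum (fun m => dcoef j (prim_coef (g k)) m * mon y m) (G k y j).
  move=> /wd wy; rewrite /G; case: eqVneq => [->|jt]; last exact: hp.
  by apply: (eq_has_sum _ (hg y k wy)) => m; rewrite dcoef_prim.
(* Only the components of [b] away from [t] are initial data; the derivative in direction [t] is
   dictated by the equation. *)
pose b' k j := if j == t then 0 else b k j.
have d4 : d / 4 <= d by lra.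
have dd4 : 0 < d / 4 by lra.
exists (d / 4), ((d / 4) ^- 2 * (d * (2 * N))),
  (fun k x => V (k, x) + \sum_j b' k j * x 0 j),
  (fun k y j => G k y j + b' k j); split=> //.
- move=> k; apply: analyticD.
    apply/analytic_wexp; exists d, (d * (2 * N)); split=> //.
    exists (prim_coef (g k)) => // x /(wdom_isoE x (ltW d0)) xd.
    by rewrite add0r; exact: (hV (k, x)).
  apply/analytic_wexp; exists d, (\sum_j `|b' k j| * iso_weight d (munit j)).
  split=> //; have wi := iso_weightP n d0.
  have : wexp (iso_weight d) (\sum_j `|b' k j| * iso_weight d (munit j))
      (fun x => \sum_j b' k j * x 0 j).
    by apply: wexp_sum => // j _; apply: wexpZ; exact: wexp_coord.
  by apply: eq_wexp => x _; rewrite add0r.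
- move=> k x y xd yd.
  have xs := le_trans xd d4; have ys := le_trans yd d4.
  have -> : V (k, x) + \sum_j b' k j * x 0 j - (V (k, y) + \sum_j b' k j * y 0 j) -
      \sum_j (G k y j + b' k j) * (x 0 j - y 0 j) =
    V (k, x) - V (k, y) - \sum_j G k y j * (x 0 j - y 0 j).
    have -> : \sum_j (G k y j + b' k j) * (x 0 j - y 0 j) =
      \sum_j G k y j * (x 0 j - y 0 j) +
      (\sum_j b' k j * x 0 j - \sum_j b' k j * y 0 j).
      rewrite -sumrB -big_split /=; apply: eq_bigr => j _; ring.
    ring.
  apply: (psum_taylor d0 (cd k)) => //.
  + by move=> i; apply: le_trans (rV_coord_le _ _) _.
  + by move=> i; apply: le_trans (rV_coord_le _ _) _.
  + by move=> i; apply: le_trans (rV_coord_le (x - y) i); rewrite !mxE.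
  + exact: (hV (k, x)).
  + exact: (hV (k, y)).
  + by move=> j; exact: hG.
- move=> k y yd; rewrite /G eqxx /b' eqxx addr0 /B -big_split /=.
  apply: eq_bigr => l _; rewrite -big_split /=; apply: eq_bigr => j jt.
  by rewrite (negbTE jt) -mulrDr addrC.
move=> k j jt; rewrite /b' (negbTE jt) -[RHS]add0r; congr (_ + _).
(* At the origin only the constant coefficient of the differentiated series counts, and it is zero
   because the primitive has no term with [m t = 0]. *)
have := hG k 0 j; rewrite normr0 => /(_ (ltW d0)) h0.
apply: (has_sum_unique h0).
have := @has_sum1 _ _ (fun m => dcoef j (prim_coef (g k)) m * mon (0 : 'rV[R]_n) m)
  (mi0 : {ffun 'I_n -> nat}).
rewrite dcoef_prim_neq// ffunE eqxx mul0r; apply=> m m0.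
apply/eqP; rewrite mulf_eq0 -[mon 0 m == 0]normr_le0; apply/orP; right.
apply: (le_trans (normr_mon_le (s := 0) m _)); first by move=> i; rewrite mxE normr0.
by rewrite expr0n mdeg_eq0 (negbTE m0).
Qed.

End CauchyKovalevskaya.

(** * Local CR functions *)

Section LocalCR.
Variable R : realType.

Lemma analytic_shift (n : nat) (f : 'rV[R]_n -> R) (a b : 'rV[R]_n) :
  analytic_fun_at f b -> analytic_fun_at (fun x => f (x - a + b)) a.
Proof.
move=> /analytic_wexp[r [N [r0 h]]]; apply/analytic_wexp; exists r, N; split=> //.
apply: eq_wexp h => x _; congr f.
by rewrite [a + x - a]addrAC subrr add0r addrC.
Qed.

Lemma analytic_neq0 (n : nat) (f : 'rV[R]_n -> R) (a : 'rV[R]_n) :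
  analytic_fun_at f a -> f a != 0 ->
  exists2 r, 0 < r & forall x, `|x - a| <= r -> f x != 0.
Proof.
move=> /analytic_wexp[r [N [r0 h]]] fa.
have h1 := wexpD h (wexp_cst (- f a) (iso_weightP n r0)).
have [||s /andP[s0 _] hs] := wexp_small r0 h1 _ (e := `|f a| / 2).
- by rewrite addr0 subrr.
- by rewrite divr_gt0// normr_gt0.
exists s => // x xa; apply: contraNneq fa => fx.
have := wexp_bound hs (x := x - a); rewrite addrCA subrr addr0 fx sub0r normrN.
move=> /(_ ((wdom_isoE _ (ltW s0)).2 xa)) h2.
by rewrite -normr_le0; lra.
Qed.

(* With z_j = eta_j - i xi_j and a_j + i b_j = - z_j / z_t, the equation
   f_t = \sum_(j != t) (a_j + i b_j) f_j says df(eta) = i df(xi). *)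
Lemma local_CR (xi eta : 'rV[R]_3 -> 'rV[R]_3) (a : 'rV[R]_3) :
  analytic_at xi a -> analytic_at eta a ->
  (forall u v : R, u *: xi a + v *: eta a = 0 -> u = 0 /\ v = 0) ->
  exists (r : R) (F : 'rV[R]_3 -> 'rV[R]_(2 + 2)), [/\ 0 < r,
    analytic_at F a, injective ('d F a) &
    forall x, `|x - a| <= r -> 'd F x (eta x) = Jstd ('d F x (xi x))].
Proof.
move=> xia etaa indep.
have [t tP] : exists t, (xi a 0 t != 0) || (eta a 0 t != 0).
  have /rV0Pn[t xt] : xi a != 0.
    apply/eqP => x0; have [] := indep 1 0; last by move/eqP; rewrite oner_eq0.
    by rewrite x0 scaler0 scale0r addr0.
  by exists t; rewrite xt.
pose X j y := xi (y + a) 0 j; pose Y j y := eta (y + a) 0 j.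
have anX j : analytic_fun_at (X j) 0.
  have := analytic_shift 0 (xia j); apply: (analytic_near_eq ltr01) => x _.
  by rewrite subr0.
have anY j : analytic_fun_at (Y j) 0.
  have := analytic_shift 0 (etaa j); apply: (analytic_near_eq ltr01) => x _.
  by rewrite subr0.
(* [D] is the squared modulus of z_t. Division by z_t is multiplication by its conjugate over [D],
   which separates the real part [al] from the imaginary part [be]. *)
pose D y := X t y * X t y + Y t y * Y t y.
have anD : analytic_fun_at D 0 by apply: analyticD; apply: analyticM.
have D0 : D 0 != 0.
  rewrite /D /X /Y add0r paddr_eq0 ?sqr_ge0// -?expr2 ?sqr_ge0//.
  by rewrite !sqrf_eq0 negb_and.
pose al j y := - ((Y j y * Y t y + X j y * X t y) * (D y)^-1).
pose be j y := (X j y * Y t y + - (Y j y * X t y)) * (D y)^-1.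
have anal j : analytic_fun_at (al j) 0.
  apply: analyticN; apply: analyticM; last exact: analyticV.
  by apply: analyticD; apply: analyticM.
have anbe j : analytic_fun_at (be j) 0.
  apply: analyticM; last exact: analyticV.
  by apply: analyticD; [|apply: analyticN]; apply: analyticM.
(* The real 2 x 2 matrix of multiplication by al + i be, with [false] for real and [true] for
   imaginary parts. [A] is block diagonal since the two CR functions do not interact. *)
pose A0 (k l : bool) j y := if k == l then al j y else if k then be j y else - be j y.
pose A (k l : 'I_2 * bool) j (y : 'rV[R]_3) :=
  (if k.1 == l.1 then A0 k.2 l.2 j y else 0).
have anA k l j : analytic_fun_at (A k l j) 0.
  move: k l => [s k] [s' l]; rewrite /A /A0 /=.
  case: (s == s'); last exact: analytic_cst.
  case: (k == l) => //; case: k => //; exact: analyticN.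
pose b (k : 'I_2 * bool) j : R := if k.2 then 0 else (j == lift t k.1)%:R.
have [d [C [U [G [d0 anU taylor eqt init]]]]] := cauchy_kovalevskaya t b anA.
have [r1 r10 Dr1] := analytic_neq0 anD D0.
have eqtE s k y : `|y| <= d ->
    G (s, k) y t = \sum_(j | j != t)
      (A0 k true j y * G (s, true) y j + A0 k false j y * G (s, false) y j).
  move=> yd; rewrite eqt//.
  rewrite (eq_bigr (fun l => \sum_(j | j != t) A (s, k) (l.1, l.2) j y *
    G (l.1, l.2) y j)); last by move=> [? ?] _.
  rewrite -(pair_bigA _ (fun s' l => \sum_(j | j != t) A (s, k) (s', l) j y *
    G (s', l) y j)) /=.
  rewrite (bigD1 s)//= [X in _ + X]big1 ?addr0; last first.
    move=> s' ss'; rewrite big1// => l _; rewrite big1// => j _.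
    by rewrite /A /= eq_sym (negbTE ss') mul0r.
  by rewrite big_bool /A /= eqxx -big_split.
have CR s y : `|y| <= d -> `|y| <= r1 ->
    \sum_j Y j y * G (s, false) y j = - \sum_j X j y * G (s, true) y j /\
    \sum_j Y j y * G (s, true) y j = \sum_j X j y * G (s, false) y j.
  move=> yd yr; have Dy : D y != 0 by apply: Dr1; rewrite subr0.
  split; apply/eqP.
    rewrite -addr_eq0 (bigD1 t)//= [X in _ + X](bigD1 t)//= !eqtE//.
    rewrite addrACA !mulr_sumr -!big_split big1//= => j jt.
    by rewrite /A0 /= /al /be; rewrite /D in Dy *; field.
  rewrite -subr_eq0 (bigD1 t)//= [X in _ - X](bigD1 t)//= !eqtE//.
  rewrite opprD addrACA !mulr_sumr -!sumrN -!big_split big1//= => j jt.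
  by rewrite /A0 /= /al /be; rewrite /D in Dy *; field.
pose kq (q : 'I_(2 + 2)) : 'I_2 * bool :=
  match fintype.split q with inl s => (s, false) | inr s => (s, true) end.
have kql s : kq (lshift 2 s) = (s, false).
  by rewrite /kq (unsplitK (inl s)).
have kqr s : kq (rshift 2 s) = (s, true).
  by rewrite /kq (unsplitK (inr s)).
pose F (x : 'rV[R]_3) : 'rV[R]_(2 + 2) := \row_q U (kq q) (x - a).
pose Jac (x : 'rV[R]_3) : 'M[R]_(3, 2 + 2) := \matrix_(i, q) G (kq q) (x - a) i.
have dF y : `|y - a| < d -> 'd F y = mulmxr (Jac y) :> ('rV[R]_3 -> 'rV[R]_(2+2)).
  move=> ya; have e0 : 0 < d - `|y - a| by rewrite subr_gt0.
  have [] // := @diff_quadratic _ _ _ F y (Jac y) (Num.max C 0) _ e0 _.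
  move=> x xy; apply/rV_norm_le.
    by rewrite mulr_ge0 ?exprn_ge0// le_max lexx orbT.
  move=> q; have xa : `|x - a| <= d.
    rewrite -(subrK y x) -addrA; apply: (le_trans (ler_normD _ _)); lra.
  have := taylor (kq q) _ _ xa (ltW ya).
  have -> : x - a - (y - a) = x - y by rewrite opprB addrA subrK.
  have -> : (F x - F y - (x - y) *m Jac y) 0 q = U (kq q) (x - a) -
      U (kq q) (y - a) - \sum_j G (kq q) (y - a) j * ((x - a) 0 j - (y - a) 0 j).
    rewrite !mxE; congr (_ - _); apply: eq_bigr => j _.
    by rewrite !mxE mulrC opprB addrA subrK.
  move=> /le_trans; apply; apply: ler_wpM2r; first exact: exprn_ge0.
  by rewrite le_max lexx.
exists (Num.min (d / 2) r1), F; split.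
- by rewrite lt_min r10 andbT divr_gt0.
- move=> q; have := analytic_shift a (anU (kq q)).
  by apply: (analytic_near_eq ltr01) => x _; rewrite mxE addr0.
- rewrite dF ?subrr ?normr0// => u v /eqP; rewrite -subr_eq0 -linearB /= => /eqP h.
  apply/eqP; rewrite -subr_eq0; apply/eqP; move: (u - v) h => {u v} w h.
  have n0 : `|0 : 'rV[R]_3| <= d by rewrite normr0 ltW.
  have hq q : \sum_i w 0 i * G (kq q) 0 i = 0.
    have /rowP/(_ q) := h; rewrite !mxE => e; rewrite -[RHS]e.
    by apply: eq_bigr => i _; rewrite mxE subrr.
  (* At the origin the initial gradient of function [s] is a unit vector with no imaginary part, so
     a single coefficient of the equation survives. *)
  have Gt s k : G (s, k) 0 t = A0 k false (lift t s) 0.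
    rewrite eqtE// (bigD1 (lift t s)) 1?eq_sym ?neq_lift//= big1 ?addr0.
      by rewrite !init 1?eq_sym ?neq_lift// /b /= eqxx mulr0 add0r mulr1.
    move=> j /andP[jt js]; rewrite !init// /b /= (negbTE js).
    by rewrite !mulr0 addr0.
  have wl s : w 0 (lift t s) + w 0 t * al (lift t s) 0 = 0.
    have := hq (lshift 2 s); rewrite kql (bigD1 t)//= Gt.
    rewrite (bigD1 (lift t s)) 1?eq_sym ?neq_lift//= big1 ?addr0.
      rewrite init 1?eq_sym ?neq_lift// /b /= eqxx mulr1 /A0 /=.
      by rewrite addrC.
    move=> j /andP[jt js]; rewrite init// /b /= (negbTE js).
    by rewrite mulr0.
  have wt s : w 0 t * be (lift t s) 0 = 0.
    have := hq (rshift 2 s); rewrite kqr (bigD1 t)//= Gt big1 ?addr0// => j jt.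
    by rewrite init// /b /= mulr0.
  (* Otherwise every [be j] vanishes at the origin, which says that Y_t xi - X_t eta is zero at [a]:
     a linear dependence, nontrivial by the choice of [t]. *)
  have wt0 : w 0 t = 0.
    apply/eqP/negPn/negP => wt0.
    have be0 j : X j 0 * Y t 0 = Y j 0 * X t 0.
      case: (unliftP t j) => [s ->|->]; last by rewrite mulrC.
      apply/eqP; rewrite -subr_eq0; have /eqP := wt s.
      by rewrite mulf_eq0 (negbTE wt0) /= mulf_eq0 invr_eq0 (negbTE D0) orbF.
    have [] := indep (Y t 0) (- X t 0).
      apply/rowP => j; rewrite !mxE; have := be0 j; rewrite /X /Y !add0r => e.
      by rewrite mulNr mulrC e mulrC subrr.
    rewrite /X /Y !add0r => e1 /eqP; rewrite oppr_eq0 => /eqP e2.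
    by move: tP; rewrite e1 e2 eqxx.
  apply/rowP => j; rewrite mxE; case: (unliftP t j) => [s ->|->] //.
  by have := wl s; rewrite wt0 mul0r addr0.
move=> x; rewrite le_min => /andP[xd xr].
have xd' : `|x - a| < d by apply: (le_lt_trans xd); lra.
rewrite dF//=.
have comp (Z : 'rV[R]_3 -> 'rV[R]_3) q : (Z x *m Jac x) 0 q =
    \sum_j Z (x - a + a) 0 j * G (kq q) (x - a) j.
  by rewrite mxE subrK; apply: eq_bigr => j _; rewrite mxE.
apply/rowP => q; rewrite /Jstd; have [h1 h2] := CR (kq q).1 (x - a) (ltW xd') xr.
case: (split_ordP q) h1 h2 => s ->.
  rewrite row_mxEl [(- rsubmx _) 0 s]mxE [rsubmx _ 0 s]mxE !comp kql kqr => h1 _.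
  exact: h1.
by rewrite row_mxEr [lsubmx _ 0 s]mxE !comp kql kqr => _ h2.
Qed.

End LocalCR.

(** * Charts and embeddings *)

Section Charts.
Variables (R : realType) (n : nat) (M : analytic_manifold R n).
Implicit Types (c : chart R n M) (q : M).

Lemma near_chart_inv c q (W : set M) : chart_dom c q -> open W -> W q ->
  \forall y \near chart_map c q,
    [/\ W (chart_inv c y), chart_dom c (chart_inv c y) &
        chart_map c (chart_inv c y) = y].
Proof.
move=> cq oW Wq.
have h1 : \forall y \near chart_map c q, (chart_map c @` chart_dom c) y.
  by apply: open_nbhs_nbhs; split; [exact: chart_img_open|exists q].
have h2 : \forall y \near chart_map c q, W (chart_inv c y).
  apply: (chart_inv_continuous cq); rewrite chart_mapK//.
  exact: open_nbhs_nbhs.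
apply: filterS2 h1 h2 => y [q' cq' <-]; by rewrite chart_mapK.
Qed.

Lemma transition_analytic c c' q : chart_around q c -> chart_around q c' ->
  analytic_at (chart_map c' \o chart_inv c) (chart_map c q).
Proof. by move=> [ac cq] [ac' c'q]; exact: atlas_analytic. Qed.

Lemma chart_at_around q : chart_around q (chart_at q).
Proof. by split; [exact: chart_at_atlas|exact: chart_at_dom]. Qed.

Lemma mdiffE m (f : M -> 'rV[R]_m) q v :
  mdiff f q v = 'd (f \o chart_inv (chart_at q)) (chart_map (chart_at q) q) v.
Proof. by rewrite /mdiff lfunE. Qed.

Lemma mdiff_comp m c q (F : 'rV[R]_n -> 'rV[R]_m) v : chart_around q c ->
  differentiable F (chart_map c q) ->
  mdiff (F \o chart_map c) q v = 'd F (chart_map c q) (mdiff (chart_map c) q v).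
Proof.
move=> cq dF; rewrite !mdiffE.
have e : (chart_map c \o chart_inv (chart_at q)) (chart_map (chart_at q) q) =
    chart_map c q by rewrite /= chart_mapK//; exact: chart_at_dom.
have dt := analytic_differentiable (transition_analytic (chart_at_around q) cq).
have := @diff_comp _ _ _ _ (chart_map c \o chart_inv (chart_at q)) F
  (chart_map (chart_at q) q) dt.
rewrite e => /(_ dF) dc.
exact: (congr1 (fun g => g v) dc).
Qed.

Lemma mdiff_chart_inj c q : chart_around q c -> injective (mdiff (chart_map c) q).
Proof.
move=> cq; set c0 := chart_at q.
have dt := analytic_differentiable (transition_analytic (chart_at_around q) cq).
have dt' := analytic_differentiable (transition_analytic cq (chart_at_around q)).
have e : (chart_map c \o chart_inv c0) (chart_map c0 q) = chart_map c q.
  by rewrite /= chart_mapK//; exact: chart_at_dom.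
have := @diff_comp _ _ _ _ (chart_map c \o chart_inv c0)
  (chart_map c0 \o chart_inv c) (chart_map c0 q) dt.
rewrite e => /(_ dt') dc.
have [_ di] : differentiable ((chart_map c0 \o chart_inv c) \o
      (chart_map c \o chart_inv c0)) (chart_map c0 q) /\
    'd ((chart_map c0 \o chart_inv c) \o (chart_map c \o chart_inv c0))
      (chart_map c0 q) = 'd id (chart_map c0 q) :> ('rV[R]_n -> 'rV[R]_n).
  apply: diff_near_eq => //.
  have oc := chart_dom_open c.
  have := near_chart_inv (chart_at_dom q) oc cq.2.
  by apply: filterS => y [h1 _ h3]; rewrite /= chart_mapK.
move=> u v; rewrite !mdiffE => uv.
have key w : 'd (chart_map c0 \o chart_inv c) (chart_map c q)
    ('d (chart_map c \o chart_inv c0) (chart_map c0 q) w) = w.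
  have := congr1 (fun g => g w) dc; rewrite /= => <-.
  have := congr1 (fun g => g w) di; rewrite /= => ->.
  by rewrite (@diff_val _ _ _ _ _ _ _ (is_diff_id _)).
exact: etrans (esym (key u)) (etrans (congr1 _ uv) (key v)).
Qed.

End Charts.

(** Along a short kernel vector h of the differential, F moves by at most |h| / (2 k), whereas the
    lower bound demands at least |h| / k. Hence the immersion property holds at every point of the
    ball, not only at its centre. *)
Lemma diff_inj_of_bound (R : realType) (n m : nat) (F : 'rV[R]_n -> 'rV[R]_m)
    (x : 'rV[R]_n) (r k : R) : 0 < r -> 0 < k -> differentiable F x ->
  (forall y, `|y - x| < r -> `|y - x| <= k * `|F y - F x|) -> injective ('d F x).
Proof.
move=> r0 k0 dF hk.
suff ker v : 'd F x v = 0 -> v = 0.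
  by move=> u v uv; apply/eqP; rewrite -subr_eq0; apply/eqP/ker;
    rewrite linearB /= uv subrr.
move=> dv; apply/eqP/negPn/negP => v0.
have nv : 0 < `|v| by rewrite normr_gt0.
have e0 : 0 < (2 * k)^-1 by rewrite invr_gt0 mulr_gt0.
have [d d0 hd] := diff_elim dF e0.
(* Scaled so that [s *: v] is nonzero and its norm is half of [Num.min d r], hence within reach of
   both estimates. *)
pose s := Num.min d r / 2 / `|v|.
have m0 : 0 < Num.min d r by rewrite lt_min d0.
have s0 : 0 < s by rewrite !divr_gt0.
have nsv : `|s *: v| = Num.min d r / 2.
  by rewrite normrZ (gtr0_norm s0) divfK// gt_eqF.
have svm : `|s *: v| < Num.min d r by rewrite nsv; lra.
have sv0 : 0 < `|s *: v| by rewrite nsv divr_gt0.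
move: svm; rewrite lt_min => /andP[svd svr].
have := hd _ svd; rewrite linearZ /= dv scaler0 subr0 => h1.
have := hk (x + s *: v); rewrite [x + _ - x]addrAC subrr add0r => /(_ svr) h2.
have h3 : k * `|F (x + s *: v) - F x| <= 2^-1 * `|s *: v|.
  have := ler_wpM2l (ltW k0) h1 => /le_trans; apply.
  by rewrite mulrA invfM mulrCA divff ?mulr1// gt_eqF.
lra.
Qed.

(** * Linear algebra of a plane with a complex structure *)

Section InvolutivePlane.
Variables (R : realType) (D : {vspace 'rV[R]_3}) (I : 'End('rV[R]_3)).
Hypotheses (dimD : \dim D = 2%N) (ID : forall v, v \in D -> I v \in D)
  (I2 : forall v, v \in D -> I (I v) = - v).

(** Applying a - b I to (a + b I) X = 0 gives (a^2 + b^2) X = 0. *)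
Lemma plane_indep X (a b : R) : X \in D -> X != 0 ->
  a *: X + b *: I X = 0 -> a = 0 /\ b = 0.
Proof.
move=> XD X0 h.
have h' : a *: I X - b *: X = 0.
  by have := congr1 I h; rewrite linear0 linearD !linearZ /= I2// scalerN.
have : (a ^+ 2 + b ^+ 2) *: X = 0.
  have -> : (a ^+ 2 + b ^+ 2) *: X =
      a *: (a *: X + b *: I X) - b *: (a *: I X - b *: X).
    rewrite scalerDr scalerBr !scalerA opprB scalerDl !expr2 [b * a]mulrC.
    by rewrite addrACA subrr addr0.
  by rewrite h h' !scaler0 subrr.
move/eqP; rewrite scaler_eq0 (negbTE X0) orbF paddr_eq0 ?sqr_ge0//.
by rewrite !sqrf_eq0 => /andP[/eqP-> /eqP->].
Qed.

Lemma plane_basis X v : X \in D -> X != 0 -> v \in D ->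
  exists a b : R, v = a *: X + b *: I X.
Proof.
move=> XD X0.
have fX : free [:: I X; X].
  rewrite free_cons seq1_free X0 andbT span_seq1; apply/vlineP => -[k e].
  have [] := @plane_indep X k (-1) XD X0.
    by rewrite e scaleN1r subrr.
  by move=> _ /eqP; rewrite oppr_eq0 oner_eq0.
have -> : D = <<[:: I X; X]>>%VS.
  apply/esym/eqP; rewrite eqEdim; apply/andP; split.
    apply/span_subvP => w; rewrite !inE => /orP[]/eqP-> //; exact: ID.
  by rewrite dimD; move: fX; rewrite /free => /eqP->.
rewrite span_cons span_seq1 => /memv_addP[_ /vlineP[k ->] [_ /vlineP[l ->] ->]].
by exists l, k; rewrite addrC.
Qed.

Lemma plane_compl u w : u \notin D -> exists2 v, v \in D & exists k : R, w = v + k *: u.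
Proof.
move=> uD.
have full : (fullv <= D + <[u]>)%VS.
  have s1 : (D <= D + <[u]>)%VS by exact: addvSl.
  have d1 : (\dim D < \dim (D + <[u]>))%N.
    rewrite ltn_neqAle dimvS// andbT (dimv_leqif_sup s1).2.
    apply: contra uD => /subvP; apply.
    by rewrite memvE addvSr.
  rewrite dimD in d1.
  rewrite -(dimv_leqif_sup (subvf _)).2 eqn_leq dimvS ?subvf//=.
  by rewrite dimvf /dim /= mul1n.
have /memv_addP[v vD [_ /vlineP[k ->] ->]] : w \in (D + <[u]>)%VS.
  by apply: (subvP full); exact: memvf.
by exists v => //; exists k.
Qed.

Lemma JstdD (u v : 'rV[R]_(2 + 2)) : Jstd (u + v) = Jstd u + Jstd v.
Proof.
by rewrite /Jstd !linearD /= add_row_mx.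
Qed.

Lemma JstdZ (k : R) (v : 'rV[R]_(2 + 2)) : Jstd (k *: v) = k *: Jstd v.
Proof. by rewrite /Jstd !linearZ /= scale_row_mx. Qed.

Lemma JstdK (v : 'rV[R]_(2 + 2)) : Jstd (Jstd v) = - v.
Proof.
rewrite /Jstd row_mxKl row_mxKr -[v in RHS]hsubmxK opp_row_mx.
by [].
Qed.

Lemma plane_J_linear (f : 'Hom('rV[R]_3, 'rV[R]_(2 + 2))) X :
  X \in D -> X != 0 -> f (I X) = Jstd (f X) ->
  forall v, v \in D -> f (I v) = Jstd (f v).
Proof.
move=> XD X0 fX v /(plane_basis XD X0)[a [b ->]].
rewrite !linearD !linearZ /= I2// JstdD !JstdZ fX JstdK scalerN linearN /=.
by rewrite scalerN.
Qed.

(** If a J-invariant [K] left the image of [D], then J would act on the one-dimensional quotient of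
    [limg f] by [f @: D] as a real scalar k with k^2 = -1. Concretely, for [w = f u] with [u]
    outside [D], writing J w = f v + k w and applying J again puts (1 + k^2) u into [D]. *)
Lemma plane_largest (f : 'Hom('rV[R]_3, 'rV[R]_(2 + 2))) :
  injective f -> (forall v, v \in D -> f (I v) = Jstd (f v)) ->
  largest_J_invariant (limg f) (f @: D)%VS.
Proof.
move=> fi fJ; split.
- exact: limgS (subvf _).
- move=> w /memv_imgP[v vD ->]; rewrite -fJ//; apply: memv_img; exact: ID.
move=> K KT KJ; apply/subvP => w wK.
have /memv_imgP[u _ wu] := subvP KT _ wK.
have /memv_imgP[u' _ wu'] := subvP KT _ (KJ _ wK).
rewrite wu memv_img//; apply/negPn/negP => uD.
have [v vD [k e]] := plane_compl u' uD.
have Jw : Jstd w = f v + k *: w by rewrite wu' e linearD linearZ /= -wu.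
have JJw : - w = f (I v) + k *: (f v + k *: w).
  by rewrite -JstdK Jw JstdD JstdZ -fJ// Jw.
have : f ((1 + k ^+ 2) *: u + (I v + k *: v)) = f 0.
  rewrite linear0 !linearD !linearZ /= -wu scalerDl scale1r expr2 -scalerA.
  by rewrite -addrA [X in w + X]addrC -addrA -scalerDr -JJw subrr.
move=> /fi h.
have uD' : (1 + k ^+ 2) *: u \in D.
  have -> : (1 + k ^+ 2) *: u = - (I v + k *: v) by apply/eqP; rewrite -addr_eq0 h.
  by rewrite memvN memvD ?memvZ// ID.
have k0 : 1 + k ^+ 2 != 0 by rewrite gt_eqF// ltr_pwDl// sqr_ge0.
by have := memvZ (1 + k ^+ 2)^-1 uD'; rewrite scalerA mulVf// scale1r (negbTE uD).
Qed.

End InvolutivePlane.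

(** * From the lower Lipschitz bound to an embedding, and the final assembly *)

Section Embedding.
Variables (R : realType) (M : analytic_manifold R 3).

Lemma chart_ball_open (c : chart R 3 M) (a : 'rV[R]_3) (r : R) :
  open (chart_dom c `&` [set q | `|chart_map c q - a| < r]).
Proof.
rewrite openE => q [cq qr].
have h1 : nbhs q (chart_dom c).
  by apply: open_nbhs_nbhs; split => //; exact: chart_dom_open.
have h2 : \forall y \near chart_map c q, `|y - a| < r.
  apply/nbhs_normP; exists (r - `|chart_map c q - a|) => /=; first by rewrite subr_gt0.
  move=> y /=; rewrite distrC => yq.
  rewrite -(subrK (chart_map c q) y) -addrA (le_lt_trans (ler_normD _ _))//.
  by rewrite -ltrBrDr.
have h3 : \forall q' \near q, `|chart_map c q' - a| < r.
  exact: (chart_map_continuous cq h2).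
by apply: filterI.
Qed.

Lemma chart_embedding (m : nat) (c : chart R 3 M) (F : 'rV[R]_3 -> 'rV[R]_m)
    (U : set M) (a : 'rV[R]_3) (r k : R) :
  atlas c -> open U -> U `<=` chart_dom c -> 0 < k ->
  (forall q, U q -> `|chart_map c q - a| < r) ->
  (forall x, `|x - a| < r -> analytic_at F x) ->
  (forall x y, `|x - a| < r -> `|y - a| < r -> `|x - y| <= k * `|F x - F y|) ->
  analytic_embedding U (F \o chart_map c).
Proof.
move=> ac oU Uc k0 Ur anF bF; have oc := chart_dom_open c.
split.
- move=> q Uq c' cq' j; have cq := Uc q Uq.
  have := analytic_comp (g := chart_map c \o chart_inv c')
    (f := fun x => F x 0 j) (a := chart_map c' q) (b := chart_map c q).
  apply; first by rewrite /= chart_mapK//; case: cq'.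
    exact: anF (Ur q Uq) j.
  exact: transition_analytic.
- move=> q Uq; have cq := Uc q Uq; have qr := Ur q Uq.
  have dF := analytic_differentiable (anF _ qr).
  have iF : injective ('d F (chart_map c q)).
    apply: (@diff_inj_of_bound _ _ _ _ _ (r - `|chart_map c q - a|) k) => //.
      by rewrite subr_gt0.
    move=> y yq; apply: bF => //.
    rewrite -(subrK (chart_map c q) y) -addrA (le_lt_trans (ler_normD _ _))//.
    by rewrite -ltrBrDr.
  move=> u v; rewrite !(@mdiff_comp _ _ _ _ c)// => /iF.
  exact: mdiff_chart_inj.
- move=> q q' Uq Uq' /= e.
  have := bF _ _ (Ur q Uq) (Ur q' Uq'); rewrite e subrr normr0 mulr0 normr_le0.
  rewrite subr_eq0 => /eqP e'.
  by rewrite -(chart_mapK (Uc q Uq)) e' chart_mapK//; exact: Uc.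
move=> W oW WU.
(* The open set for [W] is a union of balls of radius [s] around the images of points [w]. If F
   sends a point of [U] into such a ball, the lower bound places its coordinates within [k * s] of
   those of [w], hence the point lies in [W]. *)
pose good (w : M) (s : R) := [/\ W w, 0 < s & forall q, U q ->
  `|chart_map c q - chart_map c w| < k * s -> W q].
exists [set z | exists w s, good w s /\ `|z - F (chart_map c w)| < s].
  rewrite openE => z [w [s [gw zs]]].
  have : \forall y \near (z : 'rV[R]_m), exists w s,
      good w s /\ `|y - F (chart_map c w)| < s.
    apply/nbhs_normP; exists (s - `|z - F (chart_map c w)|) => /=.
      by rewrite subr_gt0.
    move=> y /=; rewrite distrC => yz; exists w, s; split=> //.
    rewrite -(subrK z y) -addrA (le_lt_trans (ler_normD _ _))//.
    by rewrite -ltrBrDr.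
  exact.
apply/seteqP; split=> [_ [w Ww <-]|z [[w [s [[Ww s0 hs] zs]]] [q Uq qz]]].
  split; last by exists w => //; exact: WU.
  have cw := Uc w (WU w Ww).
  have /nbhs_normP[e /= e0 he] := near_chart_inv cw oW Ww.
  exists w, (e / k); split; last by rewrite subrr normr0 divr_gt0.
  split=> //; first by rewrite divr_gt0.
  move=> q Uq; rewrite mulrC divfK ?gt_eqF// => qw.
  have [|+ _ _] := he (chart_map c q); first by rewrite /= distrC.
  by rewrite chart_mapK//; exact: Uc.
exists q => //; apply: hs => //.
rewrite -qz /= in zs.
have := bF _ _ (Ur q Uq) (Ur w (WU w Ww)) => /le_lt_trans; apply.
by rewrite ltr_pM2l.
Qed.

Lemma real_coord_surj (w : 'rV[R]_(2 + 2)) : exists z, real_coord z = w.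
Proof.
exists (\row_s (lsubmx w 0 s +i* rsubmx w 0 s)%C).
rewrite /real_coord -[RHS]hsubmxK; congr row_mx; apply/rowP => s.
  by rewrite !mxE.
by rewrite !mxE.
Qed.

End Embedding.

Theorem corollary1 (R : realType) (M : analytic_manifold R 3)
    (D : M -> {vspace 'rV[R]_3}) (I : M -> 'End('rV[R]_3)) :
  analytic_CR_structure D I ->
  contact_plane_field D ->
  forall p : M, exists (U : set M) (phi : M -> 'rV[R[i]]_2),
    [/\ open U, U p,
        analytic_embedding U (@real_coord R \o phi) &
        CR_induced_by D I U phi].
Proof.
move=> [[dimD frame] ID I2 anI] _ p.
have [U0 [X [Y [oU0 U0p anX anY Dspan]]]] := frame p.
have XD q : U0 q -> X q \in D q.
  by move=> /Dspan ->; rewrite memv_span ?inE ?eqxx.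
have X0 q : U0 q -> X q != 0.
  move=> U0q; apply/eqP => Xq0; have := dimD q; rewrite (Dspan q U0q) Xq0.
  have /dimvS : (<<[:: 0%R; Y q]>> <= <[Y q]>)%VS.
    by apply/span_subvP => v; rewrite !inE => /orP[]/eqP->; rewrite ?mem0v ?memv_line.
  by rewrite dim_vline => /[swap] ->; case: (Y q != 0).
have anIX := anI U0 X oU0 anX XD.
pose c := chart_at p; have cp : chart_around p c := chart_at_around p.
pose a := chart_map c p.
pose xi y := mdiff (chart_map c) (chart_inv c y) (X (chart_inv c y)).
pose eta y := mdiff (chart_map c) (chart_inv c y)
  (I (chart_inv c y) (X (chart_inv c y))).
have indep (u v : R) : u *: xi a + v *: eta a = 0 -> u = 0 /\ v = 0.
  rewrite /xi /eta /a (chart_mapK cp.2) => h.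
  have h' : u *: X p + v *: I p (X p) = 0.
    by apply: (mdiff_chart_inj cp); rewrite linear0 linearD !linearZ.
  exact: (plane_indep (I2 p) (XD p U0p) (X0 p U0p) h').
have [r1 [F [r10 anFa injF CRF]]] :=
  local_CR (anX p U0p c cp) (anIX p U0p c cp) indep.
have [r2 r20 anF] : exists2 r, 0 < r & forall x, `|x - a| < r -> analytic_at F x.
  have [r r0 hr] := @common_radius R _ (fun j r => forall x, `|x - a| < r ->
    analytic_fun_at (fun x => F x 0 j) x)
    (fun j s s' s0 ss h x xs => h x (lt_le_trans xs ss))
    (fun j => analytic_open (anFa j)).
  by exists r => // x xr j; exact: hr.
have [r3 [k [r30 k0 bF]]] := analytic_immersion anFa injF.
(* The three radii serve the CR equation, analyticity of [F] and the lower Lipschitz bound,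
   respectively. *)
pose r := Num.min r1 (Num.min r2 r3).
have r0 : 0 < r by rewrite !lt_min r10 r20.
pose U := (chart_dom c `&` [set q | `|chart_map c q - a| < r]) `&` U0.
have oU : open U by apply: openI => //; exact: chart_ball_open.
(* [F] takes its values in real coordinates; a section of [real_coord] turns it into a map to
   C^2. *)
have /choice[Phi hPhi] := @real_coord_surj R.
exists U, (Phi \o (F \o chart_map c)).
have -> : @real_coord R \o (Phi \o (F \o chart_map c)) = F \o chart_map c.
  by apply/funext => q /=; rewrite hPhi.
have Ur q : U q -> [/\ `|chart_map c q - a| < r1, `|chart_map c q - a| < r2 &
    `|chart_map c q - a| < r3].
  by case=> -[_ /=]; rewrite !lt_min => /and3P[].
have emb : analytic_embedding U (F \o chart_map c).
  apply: (@chart_embedding _ _ _ c F U a r k) => //.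
  - exact: chart_at_atlas.
  - by move=> q [[]].
  - by move=> q [[]].
  - by move=> x; rewrite !lt_min => /and3P[_ xr _]; exact: anF.
  move=> x y; rewrite !lt_min => /and3P[_ _ xr] /and3P[_ _ yr]; exact: bF.
split=> //.
  split=> //; split=> /=; last by rewrite subrr normr0.
  exact: cp.2.
move=> q Uq; have [[cq _] U0q] := Uq; have [q1 q2 q3] := Ur q Uq.
rewrite /= -[_ \o _]/(@real_coord R \o (Phi \o (F \o chart_map c))).
have -> : @real_coord R \o (Phi \o (F \o chart_map c)) = F \o chart_map c.
  by apply/funext => q' /=; rewrite hPhi.
have dF := analytic_differentiable (anF _ q2).
have cqa : chart_around q c by split=> //; exact: cp.1.
have J0 : mdiff (F \o chart_map c) q (I q (X q)) =
    Jstd (mdiff (F \o chart_map c) q (X q)).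
  rewrite !(mdiff_comp _ cqa dF).
  by have := CRF (chart_map c q) (ltW q1); rewrite /xi /eta (chart_mapK cq).
have fJ := plane_J_linear (dimD q) (ID q) (I2 q) (XD q U0q) (X0 q U0q) J0.
split=> //; apply: (plane_largest (dimD q) (ID q)) fJ.
by case: emb => _ + _ _; apply.
Qed.
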